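(* The assignments $\mathbb{V}^{\mathsf R}\colon\mathsf{StoneE}^{\mathsf R}\to\mathsf{StoneE}^{\mathsf R}$, $(X,E)\mapsto(\mathbb{V}^{\mathsf R}(X),\mathbb{V}^{\mathsf R}(E))$, $R\mapsto\mathbb{V}^{\mathsf R}(R)$, and $\mathbb{K}^{\mathsf S}\colon\mathsf{SubS5}^{\mathsf S}\to\mathsf{SubS5}^{\mathsf S}$, $(B,S)\mapsto(\mathbb{K}^{\mathsf S}(B),\mathbb{K}^{\mathsf S}(S))$, $T\mapsto\mathbb{K}^{\mathsf S}(T)$, are well-defined functors, and the following natural isomorphisms hold: $$\mathbb{V}^{\mathsf R}\circ\mathcal{Q}\simeq\mathcal{Q}\circ\mathbb{V}^{\mathsf R},\quad \mathcal{G}\circ\mathbb{V}^{\mathsf R}\simeq\mathbb{V}^{\mathsf R}\circ\mathcal{G},\quad \mathsf{Clop}\circ\mathbb{V}^{\mathsf R}\simeq\mathbb{K}^{\mathsf S}\circ\mathsf{Clop},\quad \mathsf{Uf}\circ\mathbb{K}^{\mathsf S}\simeq\mathbb{V}^{\mathsf R}\circ\mathsf{Uf},$$ where $\mathcal{Q}\colon\mathsf{StoneE}^{\mathsf R}\to\mathsf{KHaus}^{\mathsf R}$, $\mathcal{G}\colon\mathsf{KHaus}^{\mathsf R}\to\mathsf{StoneE}^{\mathsf R}$, $\mathsf{Clop}\colon\mathsf{StoneE}^{\mathsf R}\to\mathsf{SubS5}^{\mathsf S}$, $\mathsf{Uf}\colon\mathsf{SubS5}^{\mathsf S}\to\mathsf{StoneE}^{\mathsf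 R}$, and $\mathbb{V}^{\mathsf R}$ denotes the endofunctor of $\mathsf{KHaus}^{\mathsf R}$ or of $\mathsf{StoneE}^{\mathsf R}$ as appropriate.
   Context: Relations $R\colon X\to Y$ are subsets of $X\times Y$; $x\,(T\circ R)\,z$ iff $\exists y$ with $x\,R\,y$ and $y\,T\,z$; $R^\dagger$ is the converse relation. $\mathsf{KHaus}^{\mathsf R}$ is the category of compact Hausdorff spaces and closed relations (identity relations, relation composition). An $\mathsf{S5}$-subordination space is a pair $(X,E)$ with $X$ a Stone space and $E$ a closed equivalence relation on $X$. A closed relation $R\subseteq X_1\times X_2$ is compatible, as a morphism $(X_1,E_1)\to(X_2,E_2)$, if $R\circ E_1=R=E_2\circ R$. $\mathsf{StoneE}^{\mathsf R}$ is the category of $\mathsf{S5}$-subordination spaces and compatible closed relations, with relation composition; the identity on $(X,E)$ is $E$. A subordination $S\colon A\to B$ between boolean algebras is a relation $S\subseteq A\times B$ such that (S1) $0\,S\,0$, $1\,S\,1$; (S2) $a\,S\,c$, $b\,S\,c$ imply $(a\vee b)\,S\,c$; (S3) $a\,S\,c$, $a\,S\,d$ imply $a\,S\,(c\wedge d)$; (S4) $a\le b\,S\,c\le d$ implies $a\,S\,d$. An $\mathsf{S5}$-subordination on $B$ is a subordination $S\colon B\to B$ such that (S5) $a\,S\,b$ implies $a\le b$; (S6) $a\,S\,b$ implies $\neg b\,S\,\neg a$; (S7) $a\,S\,b$ implies there is $c$ with $a\,S\,c$ and $c\,S\,b$. An $\mathsf{S5}$-subordination algebra is a pair $(B,S)$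 with $S$ an $\mathsf{S5}$-subordination on the boolean algebra $B$. A subordination $T\colon B_1\to B_2$ is compatible, as a morphism $(B_1,S_1)\to(B_2,S_2)$, if $T\circ S_1=T=S_2\circ T$. $\mathsf{SubS5}^{\mathsf S}$ is the category of $\mathsf{S5}$-subordination algebras and compatible subordinations, with relation composition; the identity on $(B,S)$ is $S$. Functors. $\mathcal{Q}$ sends $(X,E)$ to the quotient space $X/E$ and $R\colon(X_1,E_1)\to(X_2,E_2)$ to $\pi_2\circ R\circ\pi_1^\dagger$, $\pi_i\colon X_i\to X_i/E_i$ the projections. $\mathcal{G}$ (a quasi-inverse of $\mathcal Q$) sends $X$ to $(\widehat X,E)$, where $g_X\colon\widehat X\to X$ is the Gleason cover (projective cover in compact Hausdorff spaces: $\widehat X$ extremally disconnected compact Hausdorff and $g_X$ an irreducible continuous surjection) and $x\,E\,y$ iff $g_X(x)=g_X(y)$; it sends $R\colon X\to Y$ to $g_Y^\dagger\circ R\circ g_X$. $\mathsf{Clop}$ sends $(X,E)$ to $(\mathsf{Clop}(X),S_E)$ and $R$ to $S_R$, where $\mathsf{Clop}(X)$ is the boolean algebra of clopens and $U\,S_R\,V$ iff $R[U]\subseteq V$. $\mathsf{Uf}$ (a quasi-inverse of $\mathsf{Clop}$) sends $(B,S)$ to $(\mathsf{Uf}(B),R_S)$ and $T$ to $R_T$, where $\mathsf{Uf}(B)$ is the Stone space of ultrafilters and $x\,R_T\,y$ iff $T[x]\subseteq y$. $\mathbb{V}^{\mathsf R}$ on $\mathsf{KHaus}^{\mathsf R}$: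 $\mathbb{V}^{\mathsf R}(X)=\mathbb{V}(X)$ is the set of closed subsets of $X$ with the topology generated by the sets $\{F\mid F\subseteq U\}$ and $\{F\mid F\cap U\neq\varnothing\}$, $U$ open in $X$; for a closed relation $R\colon X\to Y$, $F\,\mathbb{V}^{\mathsf R}(R)\,G$ iff $G\subseteq R[F]$ and $F\subseteq R^{-1}[G]$. $\mathbb{K}^{\mathsf S}$ on boolean algebras and subordinations: $\mathbb{K}^{\mathsf S}(B)=\mathbb{K}(B)$ is the quotient of the free boolean algebra over the symbols $\{\Box_a,\Diamond_a\mid a\in B\}$ by the relations $\Box_1=1$, $\Diamond_0=0$, $\Box_{a\wedge b}=\Box_a\wedge\Box_b$, $\Diamond_{a\vee b}=\Diamond_a\vee\Diamond_b$, $\Box_{a\vee b}\le\Box_a\vee\Diamond_b$, $\Box_a\wedge\Diamond_b\le\Diamond_{a\wedge b}$. An element is in disjunctive normal form if written as a finite join $\bigvee_{i=1}^n(\Box_{a_i}\wedge\Diamond_{b_{i1}}\wedge\cdots\wedge\Diamond_{b_{in_i}})$ with $0\neq b_{ij}\le a_i$; in conjunctive normal form if written as a finite meet $\bigwedge_{j=1}^m(\Diamond_{c_j}\vee\Box_{d_{j1}}\vee\cdots\vee\Box_{d_{jm_j}})$ with $c_j\le d_{jk}\ne1$ (empty joins/meets allowed). For a subordination $S\colon A\to B$: $x\,\mathcal{S}_\Box\,y$ iff $x\in\mathbb{K}(A)$, $y\in\mathbb{K}(B)$ can be written in disjunctive, resp. conjunctive, normal form so that for all $i,j$ there is $k$ with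 $a_i\,S\,d_{jk}$; $x\,\mathcal{S}_\Diamond\,y$ iff they can be so written that for all $i,j$ there is $l$ with $b_{il}\,S\,c_j$. These are subordinations, and $\mathbb{K}^{\mathsf S}(S)=\mathcal{S}$ is the least subordination $\mathbb{K}(A)\to\mathbb{K}(B)$ containing $\mathcal{S}_\Box\cup\mathcal{S}_\Diamond$. *)

(* Defs.v *)
From HB Require Import structures.
From mathcomp Require Import all_boot all_order.
From mathcomp Require Import all_classical topology.

Set Implicit Arguments.
Unset Strict Implicit.
Unset Printing Implicit Defensive.

Import Order.TTheory.

Local Open Scope classical_set_scope.
Local Open Scope relation_scope.

(* A relation R : X -> Y is an element of set (X * Y). In relation_scope,
   T \; R is the composite T o R (R first, then T) and R^-1 is the converse. *)

Definition rimage (X Y : Type) (R : set (X * Y)) (A : set X) : set Y :=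
  [set y | exists2 x, A x & R (x, y)].

Definition graph (X Y : Type) (f : X -> Y) : set (X * Y) :=
  [set p | f p.1 = p.2].

Lemma rcompA (X Y Z W : Type) (R : set (X * Y)) (S : set (Y * Z))
  (T : set (Z * W)) : T \; (S \; R) = (T \; S) \; R.
Proof.
apply/seteqP; split=> -[x w] /=.
  by move=> [z [y Rxy Syz] Tzw]; exists y => //; exists z.
by move=> [y Rxy [z Syz Tzw]]; exists z => //; exists y.
Qed.

(* Categories whose morphisms are relations composed as relations. The type obj
   may contain more than the objects: these are the A with is_obj A, and the
   morphisms A -> B are the relations R with is_hom R. Separating the data from
   its properties makes "F is a well-defined functor" a proposition about the
   assignment F. *)
Record relcat := RelCat {
  obj : Type;
  pt : obj -> Type;
  is_obj : obj -> Prop;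
  is_hom : forall A B : obj, set (pt A * pt B) -> Prop;
  idn : forall A : obj, set (pt A * pt A);
  hom_id : forall A, is_obj A -> is_hom (@idn A);
  hom_comp : forall A B C (R : set (pt A * pt B))
    (T : set (pt B * pt C)), is_obj A -> is_obj B -> is_obj C ->
    is_hom R -> is_hom T -> is_hom (T \; R);
  comp_idr : forall A B (R : set (pt A * pt B)),
    is_obj A -> is_obj B -> is_hom R -> R \; @idn A = R;
  comp_idl : forall A B (R : set (pt A * pt B)),
    is_obj A -> is_obj B -> is_hom R -> @idn B \; R = R
}.
Arguments pt {r} A.
Arguments idn {r} A.

Definition is_iso (C : relcat) (A B : obj C)
    (R : set (pt A * pt B)) : Prop :=
  is_hom R /\ exists T : set (pt B * pt A),
    [/\ is_hom T, T \; R = idn A & R \; T = idn B].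

Record assignment (C D : relcat) := Assignment {
  fobj : obj C -> obj D;
  fhom : forall A B : obj C,
    set (pt A * pt B) -> set (pt (fobj A) * pt (fobj B))
}.

Arguments fhom {C D} a {A B} R.

Definition fcomp (C D E : relcat) (G : assignment D E) (F : assignment C D)
    : assignment C E :=
  @Assignment C E (fun A => fobj G (fobj F A))
    (fun A B R => fhom G (fhom F R)).

Record is_functor (C D : relcat) (F : assignment C D) : Prop := IsFunctor {
  functor_obj : forall A, is_obj A -> is_obj (fobj F A);
  functor_hom : forall A B (R : set (pt A * pt B)),
    is_obj A -> is_obj B -> is_hom R -> is_hom (fhom F R);
  functor_id : forall A, is_obj A -> fhom F (idn A) = idn (fobj F A);
  functor_comp : forall A B E (R : set (pt A * pt B))
    (T : set (pt B * pt E)), is_obj A -> is_obj B -> is_obj E ->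
    is_hom R -> is_hom T -> fhom F (T \; R) = fhom F T \; fhom F R
}.

Definition nat_iso (C D : relcat) (F G : assignment C D) : Prop :=
  [/\ is_functor F, is_functor G &
  exists eta : forall A : obj C, set (pt (fobj F A) * pt (fobj G A)),
    (forall A, is_obj A -> is_iso (eta A)) /\
    (forall A B (R : set (pt A * pt B)),
       is_obj A -> is_obj B -> is_hom R ->
       eta B \; fhom F R = fhom G R \; eta A)].

Notation "F ∘ G" := (fcomp F G) (at level 40, left associativity).
Notation "F ≃ G" := (nat_iso F G) (at level 70, no associativity).

Definition KHaus_space (X : topologicalType) : Prop :=
  compact [set: X] /\ hausdorff_space X.

(* zero_dimensional states that distinct points are separated by a clopen; for
   compact Hausdorff spaces this means that the clopens form a basis. *)
Definition Stone_space (X : topologicalType) : Prop :=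
  KHaus_space X /\ zero_dimensional X.

Lemma KHaus_setX (X Y : topologicalType) :
  KHaus_space X -> KHaus_space Y -> KHaus_space (X * Y)%type.
Proof.
move=> [cX hX] [cY hY]; split.
  by rewrite -setXTT; exact: compact_setX.
move=> [x1 y1] [x2 y2] cl; congr pair.
  apply: hX => A B nA nB.
  have [] := cl (A `*` setT) (B `*` setT).
  - by exists (A, setT) => //; split => //; exact: filterT.
  - by exists (B, setT) => //; split => //; exact: filterT.
  by move=> [x y] [[Ax _] [Bx _]]; exists x.
apply: hY => A B nA nB.
have [] := cl (setT `*` A) (setT `*` B).
- by exists (setT, A) => //; split => //; exact: filterT.
- by exists (setT, B) => //; split => //; exact: filterT.
by move=> [x y] [[_ Ay] [_ By]]; exists y.
Qed.

Lemma closed_rcomp (X Y Z : topologicalType) (R : set (X * Y))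
    (T : set (Y * Z)) : KHaus_space X -> KHaus_space Y -> KHaus_space Z ->
  closed R -> closed T -> closed (T \; R).
Proof.
move=> kX kY kZ cR cT.
pose K := [set w : X * Y * Z | R w.1] `&`
          [set w : X * Y * Z | T (w.1.2, w.2)].
have c12 : continuous (fun w : X * Y * Z => (w.1.2, w.2)).
  move=> w; apply: cvg_pair; last exact: cvg_snd.
  exact: (continuous_comp (@cvg_fst _ _ _ _ _) (@cvg_snd _ _ _ _ _)).
have c13 : continuous (fun w : X * Y * Z => (w.1.1, w.2)).
  move=> w; apply: cvg_pair; last exact: cvg_snd.
  exact: (continuous_comp (@cvg_fst _ _ _ _ _) (@cvg_fst _ _ _ _ _)).
have cK : closed K.
  apply: closedI.
    apply: (continuous_closedP (fst : X * Y * Z -> X * Y)).1 => // w.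
    exact: cvg_fst.
  exact: (continuous_closedP _).1 c12 _ cT.
have kK : compact K.
  apply: (subclosed_compact cK (KHaus_setX (KHaus_setX kX kY) kZ).1) => //.
suff -> : T \; R = (fun w : X * Y * Z => (w.1.1, w.2)) @` K.
  apply: compact_closed; first exact: (KHaus_setX kX kZ).2.
  by apply: continuous_compact => //; exact: continuous_subspaceT.
apply/seteqP; split=> [[x z] /= [y Rxy Tyz]|_ [[[x y] z] [/= Rxy Tyz] <-]].
  by exists (x, y, z).
by exists y.
Qed.

Lemma closed_diagonal (X : topologicalType) :
  hausdorff_space X -> closed (@diagonal X).
Proof.
move=> hX [x y] cl; apply: hX => A B nA nB.
have [|[u v] [uv [Au Bv]]] := cl (A `*` B); first by exists (A, B).
by exists u; split=> //; rewrite [u]uv.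
Qed.

Lemma rcomp_diagonalr (X Y : Type) (R : set (X * Y)) : R \; diagonal = R.
Proof.
apply/seteqP; split=> -[x y] => [[z xz Rzy]|Rxy]; last by exists x.
by rewrite [x]xz.
Qed.

Lemma rcomp_diagonall (X Y : Type) (R : set (X * Y)) : diagonal \; R = R.
Proof.
apply/seteqP; split=> -[x y] => [[z Rxz zy]|Rxy]; last by exists y.
by rewrite -[y]zy.
Qed.

Definition KHausR : relcat := @RelCat topologicalType
  (fun X => X) KHaus_space (fun X Y R => closed (R : set (X * Y)))
  (fun X => @diagonal X)
  (fun X kX => closed_diagonal kX.2)
  (@closed_rcomp)
  (fun X Y R _ _ _ => rcomp_diagonalr R)
  (fun X Y R _ _ _ => rcomp_diagonall R).

Record topspace_rel := TopspaceRel {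
  space : topologicalType;
  srel : set (space * space)
}.
Arguments srel t : clear implicits.

Record is_S5_subordination_space (X : topspace_rel) : Prop := {
  S5s_stone : Stone_space (space X);
  S5s_closed : closed (srel X);
  S5s_refl : forall x, srel X (x, x);
  S5s_sym : forall x y, srel X (x, y) -> srel X (y, x);
  S5s_trans : forall x y z, srel X (x, y) -> srel X (y, z) -> srel X (x, z)
}.

Definition compatible (X Y : Type) (E : set (X * X)) (E' : set (Y * Y))
  (R : set (X * Y)) : Prop := R \; E = R /\ E' \; R = R.

Lemma compatible_rcomp (X Y Z : Type) (E1 : set (X * X)) (E2 : set (Y * Y))
    (E3 : set (Z * Z)) (R : set (X * Y)) (T : set (Y * Z)) :
  compatible E1 E2 R -> compatible E2 E3 T -> compatible E1 E3 (T \; R).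
Proof. by move=> [R1 _] [_ T2]; split; rewrite ?rcompA ?T2 // -rcompA R1. Qed.

Definition is_compatible_closed (X Y : topspace_rel)
    (R : set (space X * space Y)) : Prop :=
  closed R /\ compatible (srel X) (srel Y) R.

Lemma StoneE_id X : is_S5_subordination_space X ->
  is_compatible_closed (srel X).
Proof.
case=> _ cE rE _ tE; split=> //.
suff EE : srel X \; srel X = srel X by split.
apply/seteqP; split=> -[x z] /= => [[y Exy Eyz]|Exz]; first exact: tE Exy Eyz.
by exists x.
Qed.

Lemma StoneE_comp X Y Z (R : set (space X * space Y))
    (T : set (space Y * space Z)) : is_S5_subordination_space X ->
    is_S5_subordination_space Y -> is_S5_subordination_space Z ->
  is_compatible_closed R -> is_compatible_closed T ->
  is_compatible_closed (T \; R).
Proof.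
move=> [[kX _] _ _ _ _] [[kY _] _ _ _ _] [[kZ _] _ _ _ _] [cR eR] [cT eT].
by split; [exact: closed_rcomp|exact: compatible_rcomp eR eT].
Qed.

Definition StoneER : relcat := @RelCat topspace_rel
  space is_S5_subordination_space is_compatible_closed srel
  StoneE_id StoneE_comp
  (fun X Y R _ _ hR => hR.2.1) (fun X Y R _ _ hR => hR.2.2).

Section subordination.
Local Open Scope order_scope.
Context {d d' : Order.disp_t} {A : ctbDistrLatticeType d}
  {B : ctbDistrLatticeType d'}.

Record subordination (S : set (A * B)) : Prop := {
  sub_bot : S (\bot, \bot);
  sub_top : S (\top, \top);
  sub_join : forall a b c, S (a, c) -> S (b, c) -> S (a `|` b, c);
  sub_meet : forall a c e, S (a, c) -> S (a, e) -> S (a, c `&` e);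
  sub_le : forall a b c e, a <= b -> S (b, c) -> c <= e -> S (a, e)
}.

End subordination.

Record balg_rel := BalgRel {
  bdisp : Order.disp_t;
  balg : ctbDistrLatticeType bdisp;
  brel : set (balg * balg)
}.
Arguments brel b : clear implicits.

Record is_S5_subordination_algebra (B : balg_rel) : Prop := {
  S5a_sub : subordination (brel B);
  S5a_le : forall a b, brel B (a, b) -> (a <= b)%O;
  S5a_compl : forall a b, brel B (a, b) -> brel B (~` b, ~` a)%O;
  S5a_interp : forall a b, brel B (a, b) ->
    exists c, brel B (a, c) /\ brel B (c, b)
}.

Definition is_compatible_subordination (A B : balg_rel)
    (T : set (balg A * balg B)) : Prop :=
  subordination T /\ compatible (brel A) (brel B) T.

Lemma SubS5_id B : is_S5_subordination_algebra B ->
  is_compatible_subordination (brel B).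
Proof.
case=> sS leS _ iS; split=> //.
suff SS : brel B \; brel B = brel B by split.
apply/seteqP; split=> -[a c] /= => [[b /leS leab Sbc]|/iS [b [Sab Sbc]]].
  exact: sub_le sS _ _ _ _ leab Sbc (lexx _).
by exists b.
Qed.

Lemma SubS5_comp A B C (R : set (balg A * balg B)) (T : set (balg B * balg C)) :
  is_S5_subordination_algebra A -> is_S5_subordination_algebra B ->
  is_S5_subordination_algebra C ->
  is_compatible_subordination R -> is_compatible_subordination T ->
  is_compatible_subordination (T \; R).
Proof.
move=> _ _ _ [sR cR] [sT cT]; split; last exact: compatible_rcomp cR cT.
split=> /=.
- by exists \bot%O; [exact: sub_bot|exact: sub_bot].
- by exists \top%O; [exact: sub_top|exact: sub_top].
- move=> a b c [u Rau Tuc] [v Rbv Tvc]; exists (u `|` v)%O.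
    apply: (sub_join sR).
      exact: sub_le sR _ _ _ _ (lexx _) Rau (leUl _ _).
    exact: sub_le sR _ _ _ _ (lexx _) Rbv (leUr _ _).
  exact: sub_join.
- move=> a c e [u Rau Tuc] [v Rav Tve]; exists (u `&` v)%O.
    exact: sub_meet.
  apply: (sub_meet sT).
    exact: sub_le sT _ _ _ _ (leIl _ _) Tuc (lexx _).
  exact: sub_le sT _ _ _ _ (leIr _ _) Tve (lexx _).
- move=> a b c e leab [u Rbu Tuc] lece; exists u.
    exact: sub_le sR _ _ _ _ leab Rbu (lexx _).
  exact: sub_le sT _ _ _ _ (lexx _) Tuc lece.
Qed.

Definition SubS5S : relcat := @RelCat balg_rel
  balg is_S5_subordination_algebra is_compatible_subordination brel
  SubS5_id SubS5_comp
  (fun X Y R _ _ hR => hR.2.1) (fun X Y R _ _ hR => hR.2.2).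

(* X / E is the type of the classes E[x]; it is defined for every relation E, and
   x, y have the same class iff E (x, y) when E is an equivalence relation. *)

Section quotient.
Context {X : topologicalType} (E : set (X * X)).

Definition eclass (x : X) : set X := [set y | E (x, y)].
Definition classes : Type := set_type (range eclass).

Definition class_pi (x : X) : classes :=
  exist _ (eclass x) (mem_set (imageT eclass x)).
Definition class_repr (c : classes) : X :=
  projT1 (cid2 (set_mem (valP c))).

Lemma class_reprK : cancel class_repr class_pi.
Proof.
move=> c; apply: val_inj; rewrite /= /class_repr.
by case: cid2 => x _ /= ->.
Qed.

HB.instance Definition _ := Choice.on classes.
HB.instance Definition _ := isQuotient.Build X classes class_reprK.

End quotient.

Definition quot (X : topspace_rel) : topologicalType :=
  quotient_topology (classes (srel X)).

Definition quot_pi (X : topspace_rel) : space X -> quot X :=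
  \pi_(quotient_topology (classes (srel X)))%qT.

Definition Qf : assignment StoneER KHausR :=
  @Assignment StoneER KHausR quot
    (fun X Y R => (graph (@quot_pi Y) \; R) \; (graph (@quot_pi X))^-1).

Definition vietoris (X : topologicalType) : Type :=
  set_type [set F : set X | closed F].

Section vietoris_topology.
Context (X : topologicalType).

HB.instance Definition _ := Choice.on (vietoris X).

Definition vbox (U : set X) : set (vietoris X) := [set F | val F `<=` U].
Definition vdia (U : set X) : set (vietoris X) :=
  [set F | val F `&` U !=set0].

HB.instance Definition _ := isSubBaseTopological.Build (vietoris X)
  [set W | exists2 U, open U & W = vbox U \/ W = vdia U] id.

End vietoris_topology.

Definition vrel (X Y : topologicalType) (R : set (X * Y)) :
    set (vietoris X * vietoris Y) :=
  [set p | val p.2 `<=` rimage R (val p.1) /\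
           val p.1 `<=` rimage R^-1 (val p.2)].

Definition VK : assignment KHausR KHausR :=
  @Assignment KHausR KHausR (fun X => vietoris X) (fun X Y R => vrel R).

Definition VS : assignment StoneER StoneER :=
  @Assignment StoneER StoneER
    (fun X => @TopspaceRel (vietoris (space X)) (vrel (srel X)))
    (fun X Y R => vrel R).

Definition extremally_disconnected (X : topologicalType) : Prop :=
  forall U : set X, open U -> open (closure U).

Definition irreducible_map (X Y : topologicalType) (f : X -> Y) : Prop :=
  forall F : set X, closed F -> f @` F = setT -> F = setT.

Record is_Gleason_cover (X Y : topologicalType) (g : Y -> X) : Prop := {
  Gleason_KHaus : KHaus_space Y;
  Gleason_ed : extremally_disconnected Y;
  Gleason_continuous : continuous g;
  Gleason_surj : range g = setT;
  Gleason_irreducible : irreducible_map g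
}.

(* The Gleason cover g_X : hat X -> X is determined up to homeomorphism only, so
   the functor depends on a choice of covers. *)
Definition Gf (hat : topologicalType -> topologicalType)
    (g : forall X, hat X -> X) : assignment KHausR StoneER :=
  @Assignment KHausR StoneER
    (fun X => @TopspaceRel (hat X) [set p | g X p.1 = g X p.2])
    (fun X Y R => ((graph (g Y))^-1 \; R) \; graph (g X)).

Definition clop (X : topologicalType) : Type :=
  set_type [set U : set X | clopen U].

Section clop_algebra.
Context (X : topologicalType).
Implicit Types U V W : clop X.

HB.instance Definition _ := Choice.on (clop X).

Fact clop_disp : Order.disp_t. Proof. exact: Order.Disp. Qed.

Definition mk_clop (U : set X) (cU : clopen U) : clop X :=
  exist _ U (mem_set cU).

Lemma clopP U : clopen (val U). Proof. exact: set_mem (valP U). Qed.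

Definition clop_le U V : bool := `[< val U `<=` val V >].
Definition clop_meet U V := mk_clop (clopenI (clopP U) (clopP V)).
Definition clop_join U V := mk_clop (clopenU (clopP U) (clopP V)).
Definition clop_bot := mk_clop (@clopen0 X).
Definition clop_top := mk_clop (@clopenT X).
Definition clop_compl U := mk_clop (@clopenC X (val U) set0 (clopP U)).

Fact clop_le_def U V : clop_le U V = (clop_meet U V == U).
Proof.
apply/asboolP/eqP => [UV|<-]; last by move=> x [].
by apply: val_inj; exact/setIidPl.
Qed.
Fact clop_meetC : commutative clop_meet.
Proof. by move=> U V; apply: val_inj; exact: setIC. Qed.
Fact clop_joinC : commutative clop_join.
Proof. by move=> U V; apply: val_inj; exact: setUC. Qed.
Fact clop_meetA : associative clop_meet.
Proof. by move=> U V W; apply: val_inj; exact: setIA. Qed.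
Fact clop_joinA : associative clop_join.
Proof. by move=> U V W; apply: val_inj; exact: setUA. Qed.
Fact clop_joinKI V U : clop_meet U (clop_join U V) = U.
Proof. by apply: val_inj; rewrite /= setUC setKU. Qed.
Fact clop_meetKU V U : clop_join U (clop_meet U V) = U.
Proof. by apply: val_inj; rewrite /= setIC setKI. Qed.
Fact clop_meetUl : left_distributive clop_meet clop_join.
Proof. by move=> U V W; apply: val_inj; exact: setIUl. Qed.
Fact clop_meetxx : idempotent_op clop_meet.
Proof. by move=> U; apply: val_inj; exact: setIid. Qed.

HB.instance Definition _ := Order.isMeetJoinDistrLattice.Build clop_disp
  (clop X) clop_le_def (fun _ _ => erefl) clop_meetC clop_joinC clop_meetA
  clop_joinA clop_joinKI clop_meetKU clop_meetUl clop_meetxx.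

Fact clop_le0 U : (clop_bot <= U)%O. Proof. by apply/asboolP => x []. Qed.
Fact clop_le1 U : (U <= clop_top)%O. Proof. by apply/asboolP => x. Qed.

HB.instance Definition _ := Order.hasBottom.Build clop_disp (clop X) clop_le0.
HB.instance Definition _ := Order.hasTop.Build clop_disp (clop X) clop_le1.

Fact clop_joinxC U : (U `|` clop_compl U = \top)%O.
Proof. by apply: val_inj; exact: setUv. Qed.
Fact clop_meetxC U : (U `&` clop_compl U = \bot)%O.
Proof. by apply: val_inj; exact: setICr. Qed.

HB.instance Definition _ := Order.TBDistrLattice_hasComplement.Build clop_disp
  (clop X) clop_joinxC clop_meetxC.

End clop_algebra.

Definition clop_rel (X Y : topologicalType) (R : set (X * Y)) :
    set (clop X * clop Y) :=
  [set p | rimage R (val p.1) `<=` val p.2].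

Definition Clopf : assignment StoneER SubS5S :=
  @Assignment StoneER SubS5S
    (fun X => @BalgRel clop_disp (clop (space X)) (clop_rel (srel X)))
    (fun X Y R => clop_rel R).

Section ultrafilters.
Local Open Scope order_scope.
Context {d : Order.disp_t} (B : ctbDistrLatticeType d).

Record balg_proper_filter (F : set B) : Prop := {
  bfilter_top : F \top;
  bfilter_meet : forall a b, F a -> F b -> F (a `&` b);
  bfilter_le : forall a b, a <= b -> F a -> F b;
  bfilter_bot : ~ F \bot
}.

Definition balg_ultrafilter (F : set B) : Prop :=
  balg_proper_filter F /\
  forall G, balg_proper_filter G -> F `<=` G -> G = F.

Definition uf : Type := set_type balg_ultrafilter.

HB.instance Definition _ := Choice.on uf.

Definition uf_basic (a : B) : set uf := [set x | val x a].

HB.instance Definition _ := isSubBaseTopological.Build uf (range uf_basic) id.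

End ultrafilters.

Definition uf_rel (d d' : Order.disp_t) (A : ctbDistrLatticeType d)
    (B : ctbDistrLatticeType d') (T : set (A * B)) : set (uf A * uf B) :=
  [set p | rimage T (val p.1) `<=` val p.2].

Definition Uff : assignment SubS5S StoneER :=
  @Assignment SubS5S StoneER
    (fun B => @TopspaceRel (uf (balg B)) (uf_rel (brel B)))
    (fun A B T => uf_rel T).

(* K(B) is presented by generators and relations: boolean terms over the symbols
   Box a, Dia a, modulo the least congruence containing the axioms of boolean
   algebras and the defining relations, where s <= t stands for s /\ t = s. *)

Inductive kterm (T : Type) :=
  | KBox of T | KDia of T | KBot | KTop
  | KMeet of kterm T & kterm T | KJoin of kterm T & kterm T | KCompl of kterm T.
Arguments KBot {T}.
Arguments KTop {T}.

HB.instance Definition _ T := gen_eqMixin (kterm T).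
HB.instance Definition _ T := gen_choiceMixin (kterm T).

Section K_algebra.
Local Open Scope order_scope.
Context {d : Order.disp_t} (B : ctbDistrLatticeType d).
Implicit Types (a b : B) (s t u : kterm B).

Inductive kcong : kterm B -> kterm B -> Prop :=
  | kcong_refl s : kcong s s
  | kcong_sym s t : kcong s t -> kcong t s
  | kcong_trans s t u : kcong s t -> kcong t u -> kcong s u
  | kcong_meet s s' t t' :
      kcong s s' -> kcong t t' -> kcong (KMeet s t) (KMeet s' t')
  | kcong_join s s' t t' :
      kcong s s' -> kcong t t' -> kcong (KJoin s t) (KJoin s' t')
  | kcong_compl s s' : kcong s s' -> kcong (KCompl s) (KCompl s')
  | kcong_meetC s t : kcong (KMeet s t) (KMeet t s)
  | kcong_joinC s t : kcong (KJoin s t) (KJoin t s)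
  | kcong_meetA s t u : kcong (KMeet s (KMeet t u)) (KMeet (KMeet s t) u)
  | kcong_joinA s t u : kcong (KJoin s (KJoin t u)) (KJoin (KJoin s t) u)
  | kcong_joinKI s t : kcong (KMeet s (KJoin s t)) s
  | kcong_meetKU s t : kcong (KJoin s (KMeet s t)) s
  | kcong_meetUl s t u :
      kcong (KMeet (KJoin s t) u) (KJoin (KMeet s u) (KMeet t u))
  | kcong_bot s : kcong (KMeet KBot s) KBot
  | kcong_top s : kcong (KMeet s KTop) s
  | kcong_joinxC s : kcong (KJoin s (KCompl s)) KTop
  | kcong_meetxC s : kcong (KMeet s (KCompl s)) KBot
  | kcong_box1 : kcong (KBox \top) KTop
  | kcong_dia0 : kcong (KDia \bot) KBot
  | kcong_boxI a b : kcong (KBox (a `&` b)) (KMeet (KBox a) (KBox b))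
  | kcong_diaU a b : kcong (KDia (a `|` b)) (KJoin (KDia a) (KDia b))
  | kcong_boxU a b :
      let s := KBox (a `|` b) in let t := KJoin (KBox a) (KDia b) in
      kcong (KMeet s t) s
  | kcong_diaI a b :
      let s := KMeet (KBox a) (KDia b) in let t := KDia (a `&` b) in
      kcong (KMeet s t) s.

Definition kcongb s t : bool := `[< kcong s t >].

Fact kcongb_refl : reflexive kcongb.
Proof. by move=> s; apply/asboolP; exact: kcong_refl. Qed.
Fact kcongb_sym : symmetric kcongb.
Proof.
by move=> s t; apply/asboolP/asboolP => /kcong_sym.
Qed.
Fact kcongb_trans : transitive kcongb.
Proof.
by move=> t s u /asboolP st /asboolP tu; apply/asboolP; exact: kcong_trans tu.
Qed.

Canonical kcong_equiv := EquivRel kcongb kcongb_refl kcongb_sym kcongb_trans.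

Definition kalg : Type := {eq_quot kcong_equiv}%qT.

HB.instance Definition _ := Choice.on kalg.
HB.instance Definition _ := EqQuotient.on kalg.

Local Open Scope quotient_scope.

Fact kalg_disp : Order.disp_t. Proof. exact: Order.Disp. Qed.

Definition kcls (s : kterm B) : kalg := \pi_kalg s.

Lemma kclsP s t : kcls s = kcls t <-> kcong s t.
Proof.
split=> [/eqP|st]; first by rewrite /kcls eqmodE => /asboolP.
by apply/eqP; rewrite /kcls eqmodE; exact/asboolP.
Qed.

Lemma kcls_repr (x : kalg) : kcls (repr x) = x.
Proof. exact: reprK. Qed.

Lemma repr_kcls s : kcong (repr (kcls s)) s.
Proof. by apply/kclsP; exact: kcls_repr. Qed.

Definition kmeet (x y : kalg) : kalg := kcls (KMeet (repr x) (repr y)).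
Definition kjoin (x y : kalg) : kalg := kcls (KJoin (repr x) (repr y)).
Definition kcompl (x : kalg) : kalg := kcls (KCompl (repr x)).

Lemma kmeetE s t : kmeet (kcls s) (kcls t) = kcls (KMeet s t).
Proof. by apply/kclsP/kcong_meet; exact: repr_kcls. Qed.
Lemma kjoinE s t : kjoin (kcls s) (kcls t) = kcls (KJoin s t).
Proof. by apply/kclsP/kcong_join; exact: repr_kcls. Qed.
Lemma kcomplE s : kcompl (kcls s) = kcls (KCompl s).
Proof. by apply/kclsP/kcong_compl; exact: repr_kcls. Qed.

Lemma kalgP (P : kalg -> Prop) : (forall s, P (kcls s)) -> forall x, P x.
Proof. by move=> Ps x; rewrite -(kcls_repr x). Qed.

Fact kmeetC : commutative kmeet.
Proof.
elim/kalgP=> s; elim/kalgP=> t; rewrite !kmeetE.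
by apply/kclsP; exact: kcong_meetC.
Qed.
Fact kjoinC : commutative kjoin.
Proof.
elim/kalgP=> s; elim/kalgP=> t; rewrite !kjoinE.
by apply/kclsP; exact: kcong_joinC.
Qed.
Fact kmeetA : associative kmeet.
Proof.
elim/kalgP=> s; elim/kalgP=> t; elim/kalgP=> u; rewrite !kmeetE.
by apply/kclsP; exact: kcong_meetA.
Qed.
Fact kjoinA : associative kjoin.
Proof.
elim/kalgP=> s; elim/kalgP=> t; elim/kalgP=> u; rewrite !kjoinE.
by apply/kclsP; exact: kcong_joinA.
Qed.
Fact kjoinKI y x : kmeet x (kjoin x y) = x.
Proof.
elim/kalgP: x => s; elim/kalgP: y => t; rewrite kjoinE kmeetE.
by apply/kclsP; exact: kcong_joinKI.
Qed.
Fact kmeetKU y x : kjoin x (kmeet x y) = x.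
Proof.
elim/kalgP: x => s; elim/kalgP: y => t; rewrite kmeetE kjoinE.
by apply/kclsP; exact: kcong_meetKU.
Qed.
Fact kmeetUl : left_distributive kmeet kjoin.
Proof.
elim/kalgP=> s; elim/kalgP=> t; elim/kalgP=> u.
rewrite kjoinE !kmeetE kjoinE.
by apply/kclsP; exact: kcong_meetUl.
Qed.
Fact kmeetxx : idempotent_op kmeet.
Proof. by move=> x; rewrite -[X in kmeet _ X](kmeetKU x) kjoinKI. Qed.

HB.instance Definition _ := Order.isMeetJoinDistrLattice.Build kalg_disp
  kalg (fun _ _ => erefl) (fun _ _ => erefl) kmeetC kjoinC kmeetA
  kjoinA kjoinKI kmeetKU kmeetUl kmeetxx.

Fact kle0 (x : kalg) : (kcls KBot : kalg) <= x.
Proof.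
rewrite leEmeet; apply/eqP; elim/kalgP: x => s.
by rewrite /Order.meet /= kmeetE; apply/kclsP; exact: kcong_bot.
Qed.
Fact kle1 (x : kalg) : x <= (kcls KTop : kalg).
Proof.
rewrite leEmeet; apply/eqP; elim/kalgP: x => s.
by rewrite /Order.meet /= kmeetE; apply/kclsP; exact: kcong_top.
Qed.

HB.instance Definition _ := Order.hasBottom.Build kalg_disp kalg kle0.
HB.instance Definition _ := Order.hasTop.Build kalg_disp kalg kle1.

Fact kjoinxC (x : kalg) : x `|` kcompl x = \top.
Proof.
elim/kalgP: x => s; rewrite kcomplE /Order.join /= kjoinE.
by apply/kclsP; exact: kcong_joinxC.
Qed.
Fact kmeetxC (x : kalg) : x `&` kcompl x = \bot.
Proof.
elim/kalgP: x => s; rewrite kcomplE /Order.meet /= kmeetE.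
by apply/kclsP; exact: kcong_meetxC.
Qed.

HB.instance Definition _ := Order.TBDistrLattice_hasComplement.Build kalg_disp
  kalg kjoinxC kmeetxC.

Definition kbox a : kalg := kcls (KBox a).
Definition kdia a : kalg := kcls (KDia a).

(* p : B * seq B stands for (a_i, [:: b_i1; ...; b_in_i]) in a disjunctive, and
   for (c_j, [:: d_j1; ...; d_jm_j]) in a conjunctive normal form *)
Definition dnf_of (x : kalg) (s : seq (B * seq B)) : Prop :=
  (forall p, p \in s -> forall b, b \in p.2 -> b <> \bot /\ b <= p.1) /\
  x = \join_(p <- s) (kbox p.1 `&` \meet_(b <- p.2) kdia b).

Definition cnf_of (y : kalg) (t : seq (B * seq B)) : Prop :=
  (forall q, q \in t -> forall e, e \in q.2 -> q.1 <= e /\ e <> \top) /\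
  y = \meet_(q <- t) (kdia q.1 `|` \join_(e <- q.2) kbox e).

End K_algebra.

Section K_rel.
Context {d d' : Order.disp_t} {A : ctbDistrLatticeType d}
  {B : ctbDistrLatticeType d'} (S : set (A * B)).

Definition krel_box : set (kalg A * kalg B) :=
  [set p | exists s t, [/\ dnf_of p.1 s, cnf_of p.2 t &
    forall i j, i \in s -> j \in t -> exists2 e, e \in j.2 & S (i.1, e)]].

Definition krel_dia : set (kalg A * kalg B) :=
  [set p | exists s t, [/\ dnf_of p.1 s, cnf_of p.2 t &
    forall i j, i \in s -> j \in t -> exists2 b, b \in i.2 & S (b, j.1)]].

(* smallest is the intersection of all subordinations containing its argument,
   which is again a subordination. *)
Definition krel : set (kalg A * kalg B) :=
  smallest subordination (krel_box `|` krel_dia).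

End K_rel.

Definition KS : assignment SubS5S SubS5S :=
  @Assignment SubS5S SubS5S
    (fun B => @BalgRel kalg_disp (kalg (balg B)) (krel (brel B)))
    (fun A B T => krel T).

(* Main.v *)
Require Import Defs.
From mathcomp Require Import all_boot all_order.
From mathcomp Require Import all_classical topology.

(** The proof compares relations and subordinations through one notion: a map
    r : B -> set X that represents the boolean algebra B as the algebra of
    clopens of the compact space X ([represents]). Three pairs are of this
    kind: (uf B, B) by Stone's theorem, (X, clop X) for a Stone space X, and,
    as soon as (X, B) is one, (V X, K B), where a term over the symbols Box a
    and Dia a is read as the clopen of V X that it describes.

    Between two represented pairs, a closed relation R has a dual
    subordination (a S b iff R[r a] is contained in s b) and a subordination
    has a dual closed relation. These passages are mutually inverse and
    preserve composition, and they match closed equivalence relations with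
    S5-subordinations. Clop and Uf are the two passages, applied to the first
    two pairs.

    The theorem rests on [dual_rel_krel]: if R is dual to T, then the Vietoris
    lifting of R is dual to K(T). That the lifting of R respects K(T) is read
    off from the two kinds of generating normal forms; conversely K(T) relates
    Box a to Box b and Dia a to Dia b whenever a T b, and these pairs already
    force the two inclusions that define the lifting. Hence everything about K
    is the dual of something about V, and V is a functor on closed relations
    by an elementary computation ([vrel_comp]).

    For Uf K and V Uf, the spaces uf (K B) and V (uf B) both represent K B,
    and the isomorphism is the relation dual to K(S) across these two
    representations; for Clop V and K Clop, the algebras clop (V X) and
    K (clop X) are both represented on V X, and the isomorphism is the
    subordination dual to V(E) across them. Naturality and invertibility are
    then instances of compatibility with composition.

    The quotient and the Gleason functors are handled by calculus: a
    continuous surjection with graph P and kernel E satisfies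
    P \; P^-1 = diagonal and P^-1 \; P = E ([covers]), and the Vietoris
    lifting preserves these equations, as it preserves composition and
    converses. With p the quotient map of X and q that of V X, the first
    isomorphism is q \; V(p)^-1; with p the Gleason cover of X and q that of
    V X, the second one is V(p)^-1 \; q. *)

Set Implicit Arguments.
Unset Strict Implicit.
Unset Printing Implicit Defensive.

Import Order.Theory.

Local Open Scope classical_set_scope.
Local Open Scope relation_scope.

(** * Compact Hausdorff spaces and closed relations *)

(** Compactness in the form used throughout: for a directed open cover one
    member suffices. Otherwise the sets K minus U, for U in B, generate a
    proper filter, which has no cluster point in K. *)
Lemma compact_directed_cover (X : topologicalType) (K : set X)
    (B : set (set X)) :
  compact K -> B set0 -> (forall U V, B U -> B V -> B (U `|` V)) ->
  (forall U, B U -> open U) ->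
  (forall x, K x -> exists2 U, B U & U x) -> exists2 U, B U & K `<=` U.
Proof.
move=> cK B0 BU Bo Kcov; apply: contrapT => noU.
have PF : ProperFilter (filter_from B (fun U => K `\` U)).
  apply: filter_from_proper.
    apply: filter_from_filter; first by exists set0.
    move=> U V BUU BV; exists (U `|` V); first exact: BU.
    by move=> x [Kx /not_orP[nUx nVx]].
  move=> U BUU; apply: contrapT => KU0; apply: noU; exists U => // x Kx.
  by apply: contrapT => nUx; apply: KU0; exists x.
have [|x [Kx clx]] := cK _ PF.
  by exists set0 => // x [].
have [U BUU Ux] := Kcov x Kx.
have [||y [[_ nUy] Uy]] := clx (K `\` U) U; first by exists U.
  by apply: open_nbhs_nbhs; split=> //; exact: Bo.
exact: nUy.
Qed.

Lemma KHaus_closed_compact (X : topologicalType) (F : set X) :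
  KHaus_space X -> closed F -> compact F.
Proof. by move=> [cX _] cF; exact: (subclosed_compact cF cX). Qed.

Lemma KHaus_closed1 (X : topologicalType) (x : X) :
  KHaus_space X -> closed [set x].
Proof.
by case=> _ hX; apply: accessible_closed_set1; exact: hausdorff_accessible.
Qed.

(** Normality, stated with open sets. *)
Lemma KHaus_separate (X : topologicalType) (F G : set X) :
  KHaus_space X -> closed F -> closed G -> F `<=` ~` G ->
  exists U V, [/\ open U, open V, F `<=` U, G `<=` V & U `<=` ~` V].
Proof.
move=> [cX hX] cF cG FG.
have [|N] := @compact_normal X hX cX F cF (~` G).
  by apply/set_nbhsP; exists (~` G); split=> //; exact: closed_openC.
move=> /set_nbhsP[U [oU FU UN]] NG; exists U, (~` closure N); split=> //.
- exact/closed_openC/closed_closure.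
- by move=> x Gx /NG /(_ Gx).
- by move=> x /UN Nx; apply; exact: subset_closure.
Qed.

Section closed_relations.
Context {X Y : topologicalType} (R : set (X * Y)).

Lemma closed_converse : closed R -> closed R^-1.
Proof.
move=> cR; apply: (continuous_closedP (fun p : Y * X => (p.2, p.1))).1 cR.
by move=> p; apply: cvg_pair; [exact: cvg_snd|exact: cvg_fst].
Qed.

Lemma closed_rimage (F : set X) : KHaus_space X -> KHaus_space Y ->
  closed R -> closed F -> closed (rimage R F).
Proof.
move=> kX kY cR cF.
have -> : rimage R F = snd @` (R `&` [set p : X * Y | F p.1]).
  apply/seteqP; split=> [y [x Fx Rxy]|_ [[x y] [Rxy Fx] <-]].
    by exists (x, y).
  by exists x.
apply: compact_closed; first exact: kY.2.
apply: continuous_compact.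
  by apply: continuous_subspaceT => p; exact: cvg_snd.
apply: KHaus_closed_compact; first exact: KHaus_setX.
apply: closedI => //.
by apply: (continuous_closedP (fst : X * Y -> X)).1 cF => p; exact: cvg_fst.
Qed.

End closed_relations.

Lemma open_rimage_sub (X Y : topologicalType) (R : set (X * Y)) (U : set Y) :
  KHaus_space X -> KHaus_space Y -> closed R -> open U ->
  open [set x | rimage R [set x] `<=` U].
Proof.
move=> kX kY cR oU.
have -> : [set x | rimage R [set x] `<=` U] = ~` rimage R^-1 (~` U).
  apply/seteqP; split=> x /= RxU.
    by case=> y nUy Rxy; apply/nUy/RxU; exists x.
  by move=> y [_ -> Rxy]; apply: contrapT => nUy; apply: RxU; exists y.
apply: closed_openC; apply: closed_rimage => //; first exact: closed_converse.
exact: open_closedC.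
Qed.

Lemma rimageS (X Y : Type) (R : set (X * Y)) (A B : set X) :
  A `<=` B -> rimage R A `<=` rimage R B.
Proof. by move=> AB y [x /AB Bx Rxy]; exists x. Qed.

Lemma rimage_comp (X Y Z : Type) (R : set (X * Y)) (T : set (Y * Z))
  (A : set X) : rimage (T \; R) A = rimage T (rimage R A).
Proof.
apply/seteqP; split=> [z [x Ax [y Rxy Tyz]]|z [y [x Ax Rxy] Tyz]].
  by exists y => //; exists x.
by exists x => //; exists y.
Qed.

(** The topology generated by the subbase of the b i with i in D unfolds to
    open_from_subbase. *)
Section subbase.
Context {I : choiceType} {T : Type} (D : set I) (b : I -> set T).

Let open_from_subbase : set (set T) :=
  [set \bigcup_(V in C) V | C in subset^~ (finI_from D b)].

Lemma subbase_open i : D i -> open_from_subbase (b i).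
Proof.
move=> Di; exists [set b i]; last by rewrite bigcup_set1.
by move=> _ ->; exact: finI_from1.
Qed.

Lemma subbase_filter (F : set_system T) (x : T) (U : set T) : Filter F ->
  (forall i, D i -> b i x -> F (b i)) -> open_from_subbase U -> U x -> F U.
Proof.
move=> FF Fb [C Cfin <-] [V CV Vx].
apply: (@filterS _ F _ V); first by move=> y Vy; exists V.
have [J JD Ve] := Cfin V CV; rewrite -Ve in Vx *.
apply: filter_bigI => i Ji; apply: Fb; last exact: Vx.
by have := JD i Ji; rewrite inE.
Qed.

End subbase.

(** * The Vietoris space *)

Section vietoris_space.
Context {X : topologicalType}.
Implicit Types (F : vietoris X) (U : set X).

Definition mk_vietoris (F : set X) (cF : closed F) : vietoris X :=
  exist _ F (mem_set cF).

Lemma vietoris_closed F : closed (val F).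
Proof. exact: set_mem (valP F). Qed.

Lemma vbox_open U : open U -> open (vbox U).
Proof. by move=> oU; apply: subbase_open; exists U => //; left. Qed.

Lemma vdia_open U : open U -> open (vdia U).
Proof. by move=> oU; apply: subbase_open; exists U => //; right. Qed.

Lemma vdiaC U : vdia (~` U) = ~` vbox U.
Proof.
apply/seteqP; split=> F /=; first by move=> [x [Fx nUx]] /(_ x Fx).
by move=> FU; apply: contrapT => FU0; apply: FU => x Fx;
  apply: contrapT => nUx; apply: FU0; exists x.
Qed.

Lemma vietoris_cvg (FF : set_system (vietoris X)) F : Filter FF ->
  (forall U, open U -> vbox U F -> FF (vbox U)) ->
  (forall U, open U -> vdia U F -> FF (vdia U)) -> FF --> F.
Proof.
move=> fFF FFbox FFdia W; rewrite /= nbhsE => -[V [oV VF] VW].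
apply: filterS VW _; apply: (subbase_filter fFF _ oV VF).
by move=> _ [U oU [->|->]]; [exact: FFbox|exact: FFdia].
Qed.

End vietoris_space.

(** An ultrafilter FF converges to the set F of the points all of whose open
    neighbourhoods U satisfy FF (vdia U). If F is contained in U, each point
    outside U has an open neighbourhood that FF-almost every closed set
    misses; by compactness one such open set contains the complement of U. *)
Lemma vietoris_compact (X : topologicalType) :
  KHaus_space X -> compact [set: vietoris X].
Proof.
move=> kX; rewrite compact_ultra => FF uFF _.
pose F := [set x | forall U, open U -> U x -> FF (vdia U)].
have cF : closed F.
  move=> x clx U oU Ux; have [y [Fy Uy]] := clx U (open_nbhs_nbhs (conj oU Ux)).
  exact: Fy.
exists (mk_vietoris cF); split=> //; apply: vietoris_cvg => U oU; last first.
  by move=> [x [Fx Ux]]; exact: Fx.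
move=> FU.
have [|||V [oV FV]|x nUx|V [oV FV] nUV] :=
    @compact_directed_cover _ (~` U) [set V | open V /\ FF (vbox (~` V))].
- exact: KHaus_closed_compact kX (open_closedC oU).
- by split; [exact: open0|by apply: filterE => G x _ []].
- move=> V W [oV FV] [oW FW]; split; first exact: openU.
  apply: filterS (filterI FV FW) => G [GV GW] x Gx [Vx|Wx].
    exact: GV Vx.
  exact: GW Wx.
- by [].
- have /existsNP[V /not_implyP[oV /not_implyP[Vx nV]]] : ~ F x by move/FU.
  exists V => //; split=> //.
  have [//|] := in_ultra_setVsetC (vbox (~` V)) uFF.
  by rewrite -vdiaC setCK.
- apply: filterS FV => G GV x Gx; apply: contrapT => nUx.
  exact: GV Gx (nUV _ nUx).
Qed.

(** If x lies in F and not in G, separate x from G by open sets U and V: then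
    vdia U and vbox V separate F from G. *)
Lemma vietoris_KHaus (X : topologicalType) :
  KHaus_space X -> KHaus_space (vietoris X).
Proof.
move=> kX; split; first exact: vietoris_compact.
rewrite open_hausdorff => F G FG.
wlog [x Fx nGx] : F G FG / exists2 x, val F x & ~ val G x.
  move=> H; have [|] := pselect (exists2 x, val F x & ~ val G x).
    exact: H.
  move=> FsubG; have [x Gx nFx] : exists2 x, val G x & ~ val F x.
    apply: contrapT => GsubF; move/eqP: FG; apply; apply: val_inj.
    apply/seteqP; split=> x xin; apply: contrapT => xnin.
      by apply: FsubG; exists x.
    by apply: GsubF; exists x.
  have [||[U V] /= [UG VF] [oU oV UV]] := H G F; first by rewrite eq_sym.
    by exists x.
  by exists (V, U) => //; split=> //=; rewrite setIC.
have [|||U [V [oU oV xU GV UV]]] := @KHaus_separate X [set x] (val G) kX.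
- exact: KHaus_closed1.
- exact: vietoris_closed.
- by move=> _ ->.
exists (vdia U, vbox V) => /=.
  by split; rewrite inE //; exists x; split=> //; exact: xU.
split; [exact: vdia_open|exact: vbox_open|].
by apply/eqP/seteqP; split=> // K [[y [Ky Uy]] KV]; apply: UV Uy (KV _ Ky).
Qed.

(** * The Vietoris lifting of closed relations *)

Section vrel.
Context {X Y : topologicalType} (R : set (X * Y)).

Lemma vrel_converse : vrel R^-1 = (vrel R)^-1.
Proof. by apply/seteqP; split=> -[G F] [FG GF]; split. Qed.

(** The two inclusions in the definition are exchanged by converses, so one is
    enough. If y in G is not in R[F], separate y from the closed set R[F] by
    open sets V and W: the closed sets F' whose points have all their
    R-successors in W, and the G' that meet V, form a neighbourhood of (F, G)
    in which the inclusion still fails. *)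
Lemma vrel_closed :
  KHaus_space X -> KHaus_space Y -> closed R -> closed (vrel R).
Proof.
move=> kX kY cR.
have half (X' Y' : topologicalType) (S : set (X' * Y')) :
    KHaus_space X' -> KHaus_space Y' -> closed S ->
    closed [set p : vietoris X' * vietoris Y' |
              val p.2 `<=` rimage S (val p.1)].
  move=> kX' kY' cS; rewrite -openC openE => -[F G] /= nGF.
  have [y Gy nFy] : exists2 y, val G y & ~ rimage S (val F) y.
    apply: contrapT => nex; apply: nGF => y Gy; apply: contrapT => nFy.
    by apply: nex; exists y.
  have [||_ ->|V [W [oV oW yV FW VW]]] :=
      @KHaus_separate Y' [set y] (rimage S (val F)) kY' _ _ _ => //.
  - exact: KHaus_closed1.
  - by apply: closed_rimage => //; exact: vietoris_closed.
  have oO := open_rimage_sub kX' kY' cS oW.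
  exists (vbox [set x | rimage S [set x] `<=` W], vdia V) => /=.
    split; apply: open_nbhs_nbhs; split.
    - exact: vbox_open.
    - by move=> x Fx z [_ -> Sxz]; apply: FW; exists x.
    - exact: vdia_open.
    - by exists y; split=> //; exact: yV.
  move=> [F' G'] /= [F'W [z [G'z Vz]]] G'F'; apply: VW Vz _.
  by have [x F'x Sxz] := G'F' z G'z; apply: F'W F'x _ _; exists x.
have -> : vrel R =
    [set p : vietoris X * vietoris Y | val p.2 `<=` rimage R (val p.1)] `&`
    ([set p : vietoris Y * vietoris X |
        val p.2 `<=` rimage R^-1 (val p.1)])^-1 by [].
by apply: closedI; [|apply: closed_converse]; apply: half => //;
  exact: closed_converse.
Qed.

End vrel.

Lemma vrel_diagonal (X : topologicalType) :
  vrel (@diagonal X) = @diagonal (vietoris X).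
Proof.
apply/seteqP; split=> -[F G] /= => [[GF FG]|FG].
  apply: val_inj; apply/seteqP; split=> [x /FG[y Gy yx]|x /GF[y Fy yx]].
    by rewrite [x]yx.
  by rewrite -[x]yx.
by rewrite [F]FG; split=> x Gx; exists x.
Qed.

(** When F and H are related by the lifting of the composite, the largest
    candidate for a closed set between them, R[F] intersected with T^-1[H],
    is related to both. *)
Lemma vrel_comp (X Y Z : topologicalType) (R : set (X * Y))
    (T : set (Y * Z)) : KHaus_space X -> KHaus_space Y -> KHaus_space Z ->
  closed R -> closed T -> vrel (T \; R) = vrel T \; vrel R.
Proof.
move=> kX kY kZ cR cT; apply/seteqP; split=> -[F H] /=; last first.
  move=> [G [GF FG] [HG GH]]; split.
    move=> z /HG[y /GF[x Fx Rxy] Tyz].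
    by exists x => //; exists y.
  move=> x /FG[y /GH[z Hz Tyz] Rxy].
  by exists z => //; exists y.
move=> [HF FH].
have cG : closed (rimage R (val F) `&` rimage T^-1 (val H)).
  apply: closedI; apply: closed_rimage => //; try exact: vietoris_closed.
  exact: closed_converse.
exists (mk_vietoris cG); split=> /=.
- by move=> y [].
- move=> x Fx; have [z Hz [y Rxy Tyz]] := FH x Fx.
  by exists y => //; split; [exists x|exists z].
- move=> z Hz; have [x Fx [y Rxy Tyz]] := HF z Hz.
  by exists y => //; split; [exists x|exists z].
- by move=> y [].
Qed.

Section vrel_equivalence.
Context {X : topologicalType} (E : set (X * X)).

Lemma vrel_refl : (forall x, E (x, x)) -> forall F, vrel E (F, F).
Proof. by move=> rE F; split=> x Fx; exists x => //; exact: rE. Qed.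

Lemma vrel_sym : (forall x y, E (x, y) -> E (y, x)) ->
  forall F G, vrel E (F, G) -> vrel E (G, F).
Proof.
move=> sE F G [GF FG]; split=> [x /FG[y Gy Eyx]|y /GF[x Fx Exy]].
  by exists y => //; exact: sE.
by exists x => //; exact: sE.
Qed.

Lemma vrel_trans : (forall x y z, E (x, y) -> E (y, z) -> E (x, z)) ->
  forall F G H, vrel E (F, G) -> vrel E (G, H) -> vrel E (F, H).
Proof.
move=> tE F G H [GF FG] [HG GH]; split.
  by move=> z /HG[y /GF[x Fx Exy] Eyz]; exists x => //; exact: tE Exy Eyz.
by move=> x /FG[y /GH[z Hz Eyz] Exy]; exists z => //; exact: tE Exy Eyz.
Qed.

End vrel_equivalence.

(** * Boolean algebras of clopens *)

Section boolean_filters.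
Context {d : Order.disp_t} {B : ctbDistrLatticeType d}.
Implicit Types (a b c : B) (F : set B).

Definition mk_uf F (uF : balg_ultrafilter F) : uf B :=
  exist _ F (mem_set uF).

Lemma disj_compl_le a b : ((a `&` ~` b)%O == \bot%O) = (a <= b)%O.
Proof. by rewrite Order.CTBDistrLatticeTheory.disj_leC complK. Qed.

(** The filter generated by F and the complement of a is proper: if b in F were
    disjoint from the complement of a, then b <= a, and F would contain a. *)
Lemma filter_avoid F a : F \top%O ->
  (forall b c, F b -> F c -> F (b `&` c)%O) ->
  (forall b c, (b <= c)%O -> F b -> F c) -> ~ F a ->
  balg_proper_filter [set c | exists2 b, F b & (b `&` ~` a <= c)%O].
Proof.
move=> F1 FI Fle nFa; split.
- by exists \top%O; last exact: lex1.
- move=> c c' [b Fb bc] [b' Fb' bc']; exists (b `&` b')%O; first exact: FI.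
  rewrite lexI (le_trans _ bc) ?(le_trans _ bc') //.
    by rewrite leI2 // leIr.
  by rewrite leI2 // leIl.
- by move=> c c' cc' [b Fb bc]; exists b => //; exact: le_trans cc'.
- by case=> b Fb; rewrite lex0 disj_compl_le => /Fle /(_ Fb).
Qed.

(** Zorn's lemma is applied to the sets A such that F `|` A is a proper filter,
    rather than to the filters above F, so that the empty chain has an upper
    bound. *)
Lemma ultrafilter_extension F : balg_proper_filter F ->
  exists x : uf B, F `<=` val x.
Proof.
move=> pF.
have [|A [pFA maxA]] :=
    @Zorn_bigcup B [set A | balg_proper_filter (F `|` A)].
  move=> C CP totC; split.
  - by left; exact: bfilter_top pF.
  - move=> a b [Fa|[U CU Ua]] [Fb|[V CV Vb]].
    + by left; exact: bfilter_meet pF _ _ Fa Fb.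
    + have [] := bfilter_meet (CP V CV) (or_introl Fa) (or_intror Vb).
        by left.
      by right; exists V.
    + have [] := bfilter_meet (CP U CU) (or_intror Ua) (or_introl Fb).
        by left.
      by right; exists U.
    + wlog UV : U V a b CU Ua CV Vb / U `<=` V.
        move=> H; have [UV|VU] := totC U V CU CV.
          exact: H CU Ua CV Vb UV.
        by rewrite meetC; exact: H CV Vb CU Ua VU.
      have [] := bfilter_meet (CP V CV) (or_intror (UV _ Ua)) (or_intror Vb).
        by left.
      by right; exists V.
  - move=> a b ab [Fa|[U CU Ua]].
      by left; exact: bfilter_le pF _ _ ab Fa.
    have [] := bfilter_le (CP U CU) ab (or_intror Ua); first by left.
    by right; exists U.
  - case=> [|[U CU U0]]; first exact: bfilter_bot pF.
    by apply: (bfilter_bot (CP U CU)); right.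
have uFA : balg_ultrafilter (F `|` A).
  split=> // G pG FAG; apply/seteqP; split=> // a Ga.
  apply: contrapT => nFAa; apply: (maxA G); last first.
    rewrite /= (_ : F `|` G = G) //.
    by apply/setUidPr => b Fb; apply: FAG; left.
  split; first by move=> b Ab; apply: FAG; right.
  by move=> /(_ a Ga) Aa; apply: nFAa; right.
by exists (mk_uf uFA); exact: subsetUl.
Qed.

End boolean_filters.

(** [represents r] says that r is an isomorphism from B onto the algebra of
    clopens of X and that X is a Stone space, through the conditions that are
    used and easy to check: [rep_sep] makes X Hausdorff and zero-dimensional,
    [rep_point] makes r injective, and surjectivity onto the clopens is the
    case of [rep_between] where F and U are the same clopen. *)
Record represents (X : topologicalType) (d : Order.disp_t)
    (B : ctbDistrLatticeType d) (r : B -> set X) : Prop := Represents {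
  rep_compact : compact [set: X];
  rep_open : forall a, open (r a);
  repI : forall a b, r (a `&` b)%O = r a `&` r b;
  repC : forall a, r (~` a)%O = ~` r a;
  rep_sep : forall x y, (forall a, r a x -> r a y) -> x = y;
  rep_point : forall F : set B, balg_proper_filter F ->
    exists x, forall a, F a -> r a x
}.

Section representation.
Context {X : topologicalType} {d : Order.disp_t} {B : ctbDistrLatticeType d}.
Context {r : B -> set X} (rep : represents r).

Lemma rep0 : r \bot%O = set0.
Proof. by rewrite -(meetxC \bot%O) (repI rep) (repC rep) setICr. Qed.

Lemma rep1 : r \top%O = setT.
Proof. by rewrite -compl0 (repC rep) rep0 setC0. Qed.

Lemma repU a b : r (a `|` b)%O = r a `|` r b.
Proof.
by rewrite -[(_ `|` _)%O]complK complU (repC rep) (repI rep) !(repC rep)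
  setCI !setCK.
Qed.

(** The separation principle from which points are built: a filter that omits
    a has a point outside r a. *)
Lemma rep_avoid (F : set B) a : F \top%O ->
  (forall b c, F b -> F c -> F (b `&` c)%O) ->
  (forall b c, (b <= c)%O -> F b -> F c) -> ~ F a ->
  exists x, (forall b, F b -> r b x) /\ ~ r a x.
Proof.
move=> F1 FI Fle nFa.
have [x Fx] := rep_point rep (filter_avoid F1 FI Fle nFa); exists x; split.
  by move=> b Fb; apply: Fx; exists b => //; exact: leIl.
suff : r (~` a)%O x by rewrite (repC rep).
by apply: Fx; exists \top%O => //; rewrite meet1x.
Qed.

Lemma rep_le a b : (a <= b)%O <-> r a `<=` r b.
Proof.
split=> [ab x|rab].
  by rewrite -(meet_l ab) (repI rep) => -[].
apply: contrapT => nab.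
have [|c e ac ae|c e ce ac||x [ax nbx]] :=
    @rep_avoid [set c | (a <= c)%O] b.
- exact: lex1.
- by rewrite /= lexI; apply/andP.
- exact: le_trans ac ce.
- exact: nab.
- exact/nbx/rab/ax/lexx.
Qed.

Lemma rep_closed a : closed (r a).
Proof. by rewrite -[a]complK (repC rep); exact/open_closedC/(rep_open rep). Qed.

Lemma rep_Stone : Stone_space X.
Proof.
have zX : forall x y, x != y -> exists a, r a x /\ ~ r a y.
  move=> x y; apply: contra_neqP => nex; apply: (rep_sep rep) => a rax.
  by apply: contrapT => nray; apply: nex; exists a.
split; last first.
  move=> x y /zX[a [rax nray]]; exists (r a); split=> //.
  by split; [exact: rep_open|exact: rep_closed].
split; first exact: rep_compact rep.
rewrite open_hausdorff => x y /zX[a [rax nray]].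
exists (r a, ~` r a); rewrite ?inE //; split; first exact: rep_open.
  exact/closed_openC/rep_closed.
by rewrite setICr.
Qed.

Lemma rep_KHaus : KHaus_space X.
Proof. by case: rep_Stone. Qed.

(** First U is replaced by a neighbourhood r a of a single point x of F: the
    clopens r b that miss x cover the complement of U and are directed. Then
    the r a contained in U cover F and are directed. *)
Lemma rep_between (F U : set X) : closed F -> open U -> F `<=` U ->
  exists a, F `<=` r a /\ r a `<=` U.
Proof.
move=> cF oU FU.
have point x : F x -> exists2 a, r a x & r a `<=` U.
  move=> Fx; have [||V W [a -> rxa] [b -> rxb]|_ [a -> _]|y nUy|
                   _ [a -> rxa] nUa] :=
    @compact_directed_cover X (~` U) [set V | exists2 a, V = r a & ~ r a x].
  - exact: KHaus_closed_compact rep_KHaus (open_closedC oU).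
  - by exists \bot%O; rewrite rep0.
  - by exists (a `|` b)%O; rewrite repU // => -[].
  - exact: rep_open.
  - have [a rya nrxa] : exists2 a, r a y & ~ r a x.
      apply: contrapT => nex; apply: nUy.
      rewrite (_ : y = x); first exact: FU.
      apply: (rep_sep rep) => a rya.
      by apply: contrapT => nrxa; apply: nex; exists a.
    by exists (r a) => //; exists a.
  - exists (~` a)%O; rewrite (repC rep) // => y nray.
    by apply: contrapT => /nUa.
have [||V W [a -> aU] [b -> bU]|_ [a -> _]|x /point[a ax aU]|
         _ [a -> aU] Fa] :=
    @compact_directed_cover X F [set V | exists2 a, V = r a & r a `<=` U].
- exact: KHaus_closed_compact rep_KHaus cF.
- by exists \bot%O; rewrite rep0.
- by exists (a `|` b)%O; rewrite repU // => x [/aU|/bU].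
- exact: rep_open.
- by exists (r a) => //; exists a.
- by exists a.
Qed.

End representation.

(** * Duality between closed relations and subordinations *)

Section duals.
Context {X Y : topologicalType} {d d' : Order.disp_t}.
Context {A : ctbDistrLatticeType d} {B : ctbDistrLatticeType d'}.
Context (r : A -> set X) (s : B -> set Y).

Definition dual_rel (T : set (A * B)) : set (X * Y) :=
  [set p | forall a b, T (a, b) -> r a p.1 -> s b p.2].

Definition dual_sub (R : set (X * Y)) : set (A * B) :=
  [set p | rimage R (r p.1) `<=` s p.2].

Context (repr : represents r) (reps : represents s).

Lemma dual_rel_closed T : closed (dual_rel T).
Proof.
rewrite -openC openE => -[x y] /=.
move=> /existsNP[a /existsNP[b /not_implyP[Tab /not_implyP[rax nsby]]]].
exists (r a, ~` s b) => /=.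
  split; apply: open_nbhs_nbhs; split=> //; first exact: rep_open.
  exact/closed_openC/rep_closed.
by move=> [u v] /= [rau nsbv] uv; exact: nsbv (uv a b Tab rau).
Qed.

Lemma dual_sub_subordination R : subordination (dual_sub R).
Proof.
rewrite /dual_sub; split=> /=.
- by rewrite (rep0 repr) => y [].
- by rewrite (rep1 reps).
- move=> a b c Rac Rbc; rewrite (repU repr) => y [x [ax|bx] Rxy].
    by apply: Rac; exists x.
  by apply: Rbc; exists x.
- by move=> a c e Rac Rae; rewrite (repI reps) => y Ray; split; auto.
- move=> a b c e /(rep_le repr) ab Rbc /(rep_le reps) ce.
  by move=> y Ray; apply/ce/Rbc; exact: rimageS ab _ Ray.
Qed.

(** Stone duality for subordinations. If a T b fails, there is x in r a such
    that e T b fails for every e with x in r e; the f with e T f for some such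
    e then form a filter that omits b, and a point y of this filter outside
    s b is related to x. *)
Lemma dual_relK T : subordination T -> dual_sub (dual_rel T) = T.
Proof.
move=> sT; apply/seteqP; split=> -[a b]; last first.
  by move=> Tab y [x rax xy]; exact: xy Tab rax.
rewrite /dual_sub /= => Rab; apply: contrapT => nTab.
(* The e with e T b form an ideal that omits a; the complements of its
   elements form a filter that omits the complement of a. *)
have [||||x [Jx nCax]] := @rep_avoid _ _ _ _ repr
    [set c | T (~` c, b)%O] (~` a)%O.
- rewrite /= compl1.
  exact: sub_le sT _ _ _ _ (lexx _) (sub_bot sT) (le0x _).
- by move=> c e Tcb Teb; rewrite /= complI; exact: sub_join.
- move=> c e ce Tcb; rewrite /=.
  by apply: sub_le sT _ _ _ _ _ Tcb (lexx _); rewrite leC.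
- by rewrite /= complK.
have [||||y [Ty nby]] := @rep_avoid _ _ _ _ reps
    [set f | exists2 e, T (e, f) & r e x] b.
- by exists \top%O; [exact: sub_top|rewrite (rep1 repr)].
- move=> f f' [e Tef ex] [e' Te'f' e'x]; exists (e `&` e')%O; last first.
    by rewrite (repI repr).
  apply: (sub_meet sT).
    exact: sub_le sT _ _ _ _ (leIl _ _) Tef (lexx _).
  exact: sub_le sT _ _ _ _ (leIr _ _) Te'f' (lexx _).
- move=> f f' ff' [e Tef ex]; exists e => //.
  exact: sub_le sT _ _ _ _ (lexx _) Tef ff'.
- case=> e Teb ex; have := Jx (~` e)%O; rewrite /= complK (repC repr).
  by move=> /(_ Teb).
- apply: nby; apply: Rab; exists x; last first.
    by move=> e f Tef ex; apply: Ty; exists e.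
  by apply: contrapT => nax; apply: nCax; rewrite (repC repr).
Qed.

(** A closed relation is determined by its dual because both sides of an
    inclusion of R[F] in U can be approximated by clopens: the points whose
    R-successors lie in a clopen b form an open set, which contains F as soon
    as b contains R[F]. *)
Lemma dual_sub_between R F U : closed R -> closed F -> open U ->
  rimage R F `<=` U ->
  exists a b, [/\ F `<=` r a, dual_sub R (a, b) & s b `<=` U].
Proof.
move=> cR cF oU RFU.
have kX := rep_KHaus repr; have kY := rep_KHaus reps.
have [b [RFb bU]] := rep_between reps (closed_rimage kX kY cR cF) oU RFU.
have [|a [Fa ab]] := rep_between repr cF
  (open_rimage_sub kX kY cR (rep_open reps b)).
  by move=> x Fx y [_ -> Rxy]; apply: RFb; exists x.
exists a, b; split=> // y [x rax Rxy].
by apply: ab rax _ _; exists x.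
Qed.

Lemma dual_subK R : closed R -> dual_rel (dual_sub R) = R.
Proof.
move=> cR; apply/seteqP; split=> -[x y] /=; last first.
  by move=> Rxy a b Rab rax; apply: Rab; exists x.
move=> Rxy; apply: contrapT => nRxy.
have [|||a [b [ax Rab bU]]] := @dual_sub_between R [set x] (~` [set y]) cR.
- exact: KHaus_closed1 (rep_KHaus repr).
- exact/closed_openC/(KHaus_closed1 (rep_KHaus reps)).
- by move=> z [_ -> Rxz] zy; rewrite zy in Rxz.
- by apply: (bU y) => //; apply: Rxy Rab _; exact: ax.
Qed.

End duals.

Section dual_composition.
Context {X Y Z : topologicalType} {d d' d'' : Order.disp_t}.
Context {A : ctbDistrLatticeType d} {B : ctbDistrLatticeType d'}.
Context {C : ctbDistrLatticeType d''}.
Context {r : A -> set X} {s : B -> set Y} {t : C -> set Z}.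
Context (repr : represents r) (reps : represents s) (rept : represents t).

(** If T[R[a]] is contained in c, the closed set R[a] lies in the open set of
    the points whose T-successors all lie in c; a clopen between the two is
    the intermediate element. *)
Lemma dual_sub_comp R T : closed R -> closed T ->
  dual_sub r t (T \; R) = dual_sub s t T \; dual_sub r s R.
Proof.
move=> cR cT; apply/seteqP; split=> -[a c]; rewrite /dual_sub /= rimage_comp.
  move=> TRac.
  have kX := rep_KHaus repr; have kY := rep_KHaus reps.
  have [|b [Rab bc]] := rep_between reps
    (closed_rimage kX kY cR (rep_closed repr (a := a)))
    (open_rimage_sub kY (rep_KHaus rept) cT (rep_open rept c)).
    by move=> y Ray z [_ -> Tyz]; apply: TRac; exists y.
  exists b => // z [y rby Tyz].
  by apply: bc rby _ _; exists y.
by move=> [b Rab Tbc] z TRz; apply: Tbc; exact: rimageS Rab _ TRz.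
Qed.

(** Follows from the previous lemma, as the two passages are mutually
    inverse. *)
Lemma dual_rel_comp S T : subordination S -> subordination T ->
  dual_rel r t (T \; S) = dual_rel s t T \; dual_rel r s S.
Proof.
move=> sS sT.
have cS : closed (dual_rel r s S) by exact: dual_rel_closed.
have cT : closed (dual_rel s t T) by exact: dual_rel_closed.
rewrite -{1}(dual_relK repr reps sS) -{1}(dual_relK reps rept sT).
rewrite -dual_sub_comp // dual_subK //.
by apply: closed_rcomp cS cT; apply: rep_KHaus; eassumption.
Qed.

End dual_composition.

Section dual_equivalence.
Context {X : topologicalType} {d : Order.disp_t} {B : ctbDistrLatticeType d}.
Context {r : B -> set X} (rep : represents r).

(** Reflexivity, symmetry and transitivity of E give (S5), (S6) and (S7), the
    last one by compatibility of duality with E \; E = E. *)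
Lemma dual_sub_S5 (E : set (X * X)) : closed E -> (forall x, E (x, x)) ->
  (forall x y, E (x, y) -> E (y, x)) ->
  (forall x y z, E (x, y) -> E (y, z) -> E (x, z)) ->
  is_S5_subordination_algebra (BalgRel (dual_sub r r E)).
Proof.
move=> cE rE sE tE; split=> /=.
- exact: dual_sub_subordination.
- by move=> a b Eab; apply/(rep_le rep) => x rax; apply: Eab; exists x.
- move=> a b Eab x [y]; rewrite !(repC rep) => nrby Eyx rax.
  by apply: nrby; apply: Eab; exists x => //; exact: sE.
- move=> a b Eab.
  have EE : E \; E = E.
    apply/seteqP; split=> -[x z] /= => [[y Exy Eyz]|Exz].
      exact: tE Exy Eyz.
    by exists x.
  have : dual_sub r r (E \; E) (a, b) by rewrite EE.
  by rewrite (dual_sub_comp rep rep rep) // => -[c Eac Ecb]; exists c.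
Qed.

Lemma dual_rel_S5 (S : set (B * B)) :
  is_S5_subordination_algebra (BalgRel S) ->
  is_S5_subordination_space (TopspaceRel (dual_rel r r S)).
Proof.
move=> [/= sS leS cS iS]; split=> /=.
- exact: rep_Stone rep.
- exact: dual_rel_closed.
- by move=> x a b /leS/(rep_le rep); exact.
- move=> x y xy a b /cS Sba ray; apply: contrapT => nrbx.
  have := xy _ _ Sba; rewrite !(repC rep) => /(_ nrbx).
  exact.
- by move=> x y z xy yz a c /iS[b [Sab Sbc]] /(xy _ _ Sab)/(yz _ _ Sbc).
Qed.

End dual_equivalence.

(** * The three representations *)

Section ultrafilter_space.
Context {d : Order.disp_t} {B : ctbDistrLatticeType d}.
Implicit Types (x : uf B) (a b : B).

Lemma uf_proper x : balg_proper_filter (val x).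
Proof. by case: (set_mem (valP x)). Qed.

Lemma uf_compl x a : val x (~` a)%O <-> ~ val x a.
Proof.
have px := uf_proper x; split=> [xna xa|nxa].
  by apply: (bfilter_bot px); rewrite -(meetxC a); 
  exact: (bfilter_meet px).
have [y xy] := ultrafilter_extension
  (filter_avoid (bfilter_top px) (bfilter_meet px) (bfilter_le px) nxa).
have <- : val y = val x.
  case: (set_mem (valP x)) => _ /(_ (val y) (uf_proper y)) -> // b xb.
  by apply: xy; exists b => //; exact: leIl.
apply: xy; exists \top%O; last by rewrite meet1x.
exact: (bfilter_top px).
Qed.

Lemma uf_join x a b : val x (a `|` b)%O <-> val x a \/ val x b.
Proof.
have px := uf_proper x; split=> [xab|[]]; last 2 first.
- by apply: (bfilter_le px) _ _ _; exact: leUl.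
- by apply: (bfilter_le px) _ _ _; exact: leUr.
have [|nxa] := pselect (val x a); first by left.
have [|nxb] := pselect (val x b); first by right.
have /uf_compl : val x (~` (a `|` b))%O by
  rewrite complU; apply: (bfilter_meet px) _ _ _ _; exact/uf_compl.
by case.
Qed.

(** Compactness: for an ultrafilter FF of subsets of uf B, the a such that
    FF (uf_basic a) form a proper filter of B, and FF converges to any
    ultrafilter of B that extends it. *)
Lemma uf_represents : represents (@uf_basic d B).
Proof.
have uC a : uf_basic (~` a)%O = ~` uf_basic a.
  by apply/seteqP; split=> x /(uf_compl x a).
have uI a b : uf_basic (a `&` b)%O = uf_basic a `&` uf_basic b.
  apply/seteqP; split=> x; have px := uf_proper x.
    by move=> xab; split; apply: (bfilter_le px) _ _ _ xab;
      [exact: leIl|exact: leIr].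
  by move=> [xa xb]; exact: (bfilter_meet px) _ _ xa xb.
split.
- rewrite compact_ultra => FF uFF _.
  have [|x Fx] := @ultrafilter_extension _ B [set a | FF (uf_basic a)].
    split.
    - by apply: filterE => x; exact: bfilter_top (uf_proper x).
    - by move=> a b Fa Fb; rewrite /= uI; exact: filterI.
    - move=> a b ab; apply: filterS => x.
      exact: bfilter_le (uf_proper x) _ _ ab.
    - by move=> /filter_ex[x]; exact: bfilter_bot (uf_proper x).
  exists x; split=> // W; rewrite /= nbhsE => -[V [oV Vx] VW].
  apply: filterS VW _; apply: (subbase_filter _ _ oV Vx).
  move=> _ [a _ <-] xa.
  have [//|] := in_ultra_setVsetC (uf_basic a) uFF.
  by rewrite -uC => /Fx/uf_compl.
- by move=> a; apply: subbase_open; exists a.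
- exact: uI.
- exact: uC.
- move=> x y xy; apply: val_inj; apply/esym.
  by case: (set_mem (valP x)) => _; apply => //; exact: uf_proper.
- by move=> F /ultrafilter_extension[x Fx]; exists x.
Qed.

End ultrafilter_space.

(** A proper filter of clopens generates a proper filter of sets; each of its
    clopens, being closed, contains all its cluster points. *)
Lemma clop_represents (X : topologicalType) :
  Stone_space X -> represents (fun U : clop X => val U).
Proof.
move=> [[cX hX] zX]; split=> //.
- by move=> U; case: (clopP U).
- move=> x y xy; apply: contrapT => /eqP /zX[U [cU Ux nUy]].
  exact: nUy (xy (mk_clop cU) Ux).
- move=> F pF.
  have PF : ProperFilter (filter_from F (fun U => val U)).
    apply: filter_from_proper.
      apply: filter_from_filter; first by exists \top%O;
        exact: (bfilter_top pF).
      move=> U V FU FV; exists (U `&` V)%O => //.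
      exact: (bfilter_meet pF).
    move=> U FU; apply: contrapT => U0; apply: (bfilter_bot pF).
    suff <- : U = \bot%O by [].
    by apply: val_inj; apply/seteqP; split=> // x Ux; apply: U0; exists x.
  have [|x [_ clx]] := cX _ PF; first exact: filterT.
  exists x => U FU; have [_] := clopP U; apply; move=> V Vx.
  by apply: clx Vx; exists U.
Qed.

Section kalg_operations.
Local Open Scope order_scope.
Context {d : Order.disp_t} {B : ctbDistrLatticeType d}.
Implicit Types (s t : kterm B) (a b : B).

Lemma kcls_meet s t : kcls (KMeet s t) = (kcls s : kalg B) `&` kcls t.
Proof. by rewrite -kmeetE. Qed.

Lemma kcls_join s t : kcls (KJoin s t) = (kcls s : kalg B) `|` kcls t.
Proof. by rewrite -kjoinE. Qed.

Lemma kcls_compl s : kcls (KCompl s) = ~` (kcls s : kalg B).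
Proof. by rewrite -kcomplE. Qed.

Lemma kbox1 : kbox \top = \top :> kalg B.
Proof. exact/kclsP/kcong_box1. Qed.

Lemma kdia0 : kdia \bot = \bot :> kalg B.
Proof. exact/kclsP/kcong_dia0. Qed.

Lemma kboxI a b : kbox (a `&` b) = kbox a `&` kbox b.
Proof. by rewrite -kcls_meet; exact/kclsP/kcong_boxI. Qed.

Lemma kboxU_le a b : kbox (a `|` b) <= kbox a `|` kdia b.
Proof.
by rewrite leEmeet -kcls_join -kcls_meet; exact/eqP/kclsP/kcong_boxU.
Qed.

Lemma kdiaI_le a b : kbox a `&` kdia b <= kdia (a `&` b).
Proof.
rewrite leEmeet -(kcls_meet (KBox a) (KDia b)) -kcls_meet.
exact/eqP/kclsP/kcong_diaI.
Qed.

(** The two mixed relations between Box and Dia make Dia a the complement of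
    Box (~` a). *)
Lemma uf_kdia (u : uf (kalg B)) a :
  val u (kdia a) <-> ~ val u (kbox (~` a)).
Proof.
have pu := uf_proper u; split=> [udia ubox|nubox].
  apply: (bfilter_bot pu); rewrite -kdia0 -(meetxC a) meetC.
  apply: (bfilter_le pu) _ _ (kdiaI_le _ _) _.
  exact: (bfilter_meet pu) _ _ ubox udia.
have /uf_join[] // : val u (kbox (~` a) `|` kdia a).
apply: (bfilter_le pu) _ _ (kboxU_le _ _) _.
by rewrite joinC joinxC kbox1; exact: (bfilter_top pu).
Qed.

End kalg_operations.

Section krep.
Context {X : topologicalType} {d : Order.disp_t} {B : ctbDistrLatticeType d}.
Context (r : B -> set X).

Fixpoint keval (t : kterm B) : set (vietoris X) :=
  match t with
  | KBox a => vbox (r a)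
  | KDia a => vdia (r a)
  | KBot => set0
  | KTop => setT
  | KMeet t u => keval t `&` keval u
  | KJoin t u => keval t `|` keval u
  | KCompl t => ~` keval t
  end.

Definition krep (k : kalg B) : set (vietoris X) := keval (repr k).

Context (rep : represents r).

Lemma keval_kcong t u : kcong t u -> keval t = keval u.
Proof.
elim=> //=.
- by move=> t1 t2 t3 _ -> _ ->.
- by move=> t1 t2 u1 u2 _ -> _ ->.
- by move=> t1 t2 u1 u2 _ -> _ ->.
- by move=> t1 t2 _ ->.
- by move=> *; exact: setIC.
- by move=> *; exact: setUC.
- by move=> *; exact: setIA.
- by move=> *; exact: setUA.
- by move=> t1 t2; rewrite setUC setKU.
- by move=> t1 t2; rewrite setIC setKI.
- by move=> *; exact: setIUl.
- by move=> *; exact: set0I.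
- by move=> *; exact: setIT.
- by move=> *; exact: setUv.
- by move=> *; exact: setICr.
- by rewrite (rep1 rep); apply/seteqP; split.
- by rewrite (rep0 rep); apply/seteqP; split=> // F [x []].
- by move=> a b; rewrite (repI rep); apply/seteqP; split=> F;
    rewrite /vbox /= subsetI.
- move=> a b; rewrite (repU rep) /vdia; apply/seteqP; split=> F /=.
    by move=> [x [Fx [ax|bx]]]; [left|right]; exists x.
  by move=> [] [x [Fx rx]]; exists x; split=> //; [left|right].
- move=> a b; rewrite (repU rep); apply/setIidPl => F /= Fab.
  have [|nFb] := pselect (vdia (r b) F); first by right.
  left=> x Fx; have [//|bx] := Fab x Fx.
  by exfalso; apply: nFb; exists x.
- move=> a b; rewrite (repI rep); apply/setIidPl => F /= [Fa [x [Fx bx]]].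
  by exists x; split=> //; split=> //; exact: Fa.
Qed.

Lemma krepE t : krep (kcls t) = keval t.
Proof. exact/keval_kcong/repr_kcls. Qed.

Lemma krep_kbox a : krep (kbox a) = vbox (r a).
Proof. exact: krepE. Qed.

Lemma krep_kdia a : krep (kdia a) = vdia (r a).
Proof. exact: krepE. Qed.

(** An ultrafilter u of K B is the one of the closed set F that is the
    intersection of the r a with Box a in u: if F is contained in r a but
    Box a is not in u, the filter of the b with Box b in u omits a, and has a
    point outside r a, which lies in F. The case of Dia a follows by taking
    complements, and the other terms by induction. Points are separated by
    the Box a, since a closed set and a point outside it are separated by some
    r a. *)
Lemma krep_represents : represents krep.
Proof.
have kX := rep_KHaus rep.
have keval_clopen t : clopen (keval t).
  elim: t => /= [a|a|||t ct u cu|t ct u cu|t ct].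
  - split; first exact/vbox_open/rep_open.
    rewrite -openC -vdiaC -(repC rep).
    exact/vdia_open/rep_open.
  - split; first exact/vdia_open/rep_open.
    rewrite -[r a]setCK vdiaC -(repC rep).
    exact/open_closedC/vbox_open/rep_open.
  - exact: clopen0.
  - exact: clopenT.
  - exact: clopenI.
  - exact: clopenU.
  - exact: clopenC set0 ct.
split.
- exact: vietoris_compact.
- by move=> k; case: (keval_clopen (repr k)).
- apply: (@kalgP _ B) => t; apply: (@kalgP _ B) => u.
  by rewrite -kcls_meet !krepE.
- by apply: (@kalgP _ B) => t; rewrite -kcls_compl !krepE.
- have sub F G : (forall k, krep k F -> krep k G) -> val G `<=` val F.
    move=> FG x Gx; apply: contrapT => nFx.
    have [|||a [Fa ax]] := rep_between rep (F := val F) (U := ~` [set x]).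
    - exact: vietoris_closed.
    - exact/closed_openC/KHaus_closed1.
    - by move=> y Fy yx; rewrite yx in Fy.
    - have := FG (kbox a); rewrite krep_kbox => /(_ Fa x Gx) /ax.
      exact.
  move=> F G FG; apply: val_inj; apply/seteqP; split; last exact: sub.
  apply: sub; apply: (@kalgP _ B) => t Gt; apply: contrapT => nFt.
  have := FG (kcls (KCompl t)); rewrite !krepE in Gt nFt * => /(_ nFt).
  by apply.
- move=> f /ultrafilter_extension[u fu].
  have pu := uf_proper u.
  have cF : closed [set x | forall a, val u (kbox a) -> r a x].
    rewrite (_ : [set _ | _] = \bigcap_(a in [set a | val u (kbox a)]) r a).
      by apply: closed_bigI => a _; exact: rep_closed.
    by apply/seteqP; split=> x.
  have vbox_u a : vbox (r a) (mk_vietoris cF) -> val u (kbox a).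
    move=> Fa; apply: contrapT => nua.
    have [||||x [fx]] := @rep_avoid _ _ _ _ rep [set b | val u (kbox b)] a.
    - by rewrite /= kbox1; exact: (bfilter_top pu).
    - by move=> b c ub uc; rewrite /= kboxI; exact: (bfilter_meet pu).
    - move=> b c bc; apply: (bfilter_le pu).
      by rewrite -(meet_l bc) kboxI leIr.
    - exact: nua.
    - by apply; apply: Fa.
  have ukeval t : val u (kcls t) <-> keval t (mk_vietoris cF).
    elim: t => /= [a|a|||t IHt v IHv|t IHt v IHv|t IHt].
    - by split=> [ua x|/vbox_u//]; exact.
    - rewrite -[r a]setCK vdiaC -(repC rep); apply: (iff_trans (uf_kdia u a)).
      split=> nua; first by move/vbox_u.
      by move=> ua; apply: nua => x; exact.
    - by split=> // /(bfilter_bot pu).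
    - by split=> // _; exact: (bfilter_top pu).
    - rewrite kcls_meet; split=> [utv|[/IHt ut /IHv uv]].
        by split; [apply/IHt|apply/IHv]; apply: (bfilter_le pu) utv;
          [exact: leIl|exact: leIr].
      exact: (bfilter_meet pu).
    - rewrite kcls_join; apply: (iff_trans (uf_join u _ _)).
      by split=> -[/IHt|/IHv]; [left|right|left|right].
    - rewrite kcls_compl; apply: (iff_trans (uf_compl u _)).
      by split=> nut /IHt.
  exists (mk_vietoris cF); apply: (@kalgP _ B) => t /fu/ukeval.
  by rewrite krepE.
Qed.

End krep.

(** * Duality for the lifted subordination *)

Section representation_of_bigops.
Context {X : topologicalType} {d : Order.disp_t} {B : ctbDistrLatticeType d}.
Context {r : B -> set X} (rep : represents r).
Context {I : eqType} (f : I -> B).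
Implicit Type l : seq I.

Lemma rep_bigjoin l x :
  r (\join_(i <- l) f i)%O x <-> exists2 i, i \in l & r (f i) x.
Proof.
elim: l => [|i l IHl]; first by rewrite big_nil (rep0 rep); split=> // -[].
rewrite big_cons (repU rep); split=> [[fx|/IHl[j jl fx]]|[j]].
- by exists i; rewrite ?mem_head.
- by exists j; rewrite // in_cons jl orbT.
- rewrite in_cons => /orP[/eqP-> fx|jl fx]; first by left.
  by right; apply/IHl; exists j.
Qed.

Lemma rep_bigmeet l x :
  r (\meet_(i <- l) f i)%O x <-> forall i, i \in l -> r (f i) x.
Proof.
elim: l => [|i l IHl]; first by rewrite big_nil (rep1 rep); split.
rewrite big_cons (repI rep); split=> [[fx /IHl flx] j|fx].
  by rewrite in_cons => /orP[/eqP->|/flx].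
split; first exact: fx (mem_head _ _).
by apply/IHl => j jl; apply: fx; rewrite in_cons jl orbT.
Qed.

End representation_of_bigops.

Section krel_duality.
Context {d d' : Order.disp_t}.
Context {A : ctbDistrLatticeType d} {B : ctbDistrLatticeType d'}.
Context (T : set (A * B)).

Lemma krel_subordination : subordination (krel T).
Proof.
split.
- by move=> S [sS _]; exact: sub_bot.
- by move=> S [sS _]; exact: sub_top.
- move=> x y z xz yz S SP; apply: (sub_join SP.1); first exact: xz SP.
  exact: yz SP.
- move=> x y z xy xz S SP; apply: (sub_meet SP.1); first exact: xy SP.
  exact: xz SP.
- move=> x y z w xy yz zw S SP; apply: (sub_le SP.1 xy _ zw).
  exact: yz SP.
Qed.

(** Box a is the disjunctive normal form with the single entry (a, [::]), and
    Box b the conjunctive one with the single entry (\bot, [:: b]), because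
    Dia \bot = \bot. The latter requires b != \top, but Box \top is the top
    element. *)
Lemma krel_kbox a b : T (a, b) -> krel T (kbox a, kbox b).
Proof.
move=> Tab; have sK := krel_subordination.
have [->|/eqP b1] := eqVneq b \top%O.
  rewrite kbox1; exact: (sub_le sK) (lex1 _) (sub_top sK) (lexx _).
apply: sub_gen_smallest; left.
exists [:: (a, [::])], [:: (\bot%O, [:: b])]; split.
- split; first by move=> p /[!inE]/eqP ->.
  by rewrite big_seq1 /= big_nil meetx1.
- split; last by rewrite big_seq1 /= big_seq1 kdia0 join0x.
  by move=> p /[!inE]/eqP -> e /[!inE]/eqP ->; split; first exact: le0x.
- move=> i j; rewrite !inE => /eqP -> /eqP -> /=.
  by exists b; rewrite ?inE.
Qed.

(** Dually to [krel_kbox], Dia a = Box \top `&` Dia a is a disjunctive normal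
    form if a != \bot, while Dia \bot is the bottom element. *)
Lemma krel_kdia a b : T (a, b) -> krel T (kdia a, kdia b).
Proof.
move=> Tab; have sK := krel_subordination.
have [->|/eqP a0] := eqVneq a \bot%O.
  rewrite kdia0; exact: (sub_le sK) (lexx _) (sub_bot sK) (le0x _).
apply: sub_gen_smallest; right.
exists [:: (\top%O, [:: a])], [:: (b, [::])]; split.
- split; last by rewrite big_seq1 /= big_seq1 kbox1 meet1x.
  by move=> p /[!inE]/eqP -> e /[!inE]/eqP ->; split=> //; exact: lex1.
- split; first by move=> p /[!inE]/eqP ->.
  by rewrite big_seq1 /= big_nil joinx0.
- move=> i j; rewrite !inE => /eqP -> /eqP -> /=.
  by exists a; rewrite ?inE.
Qed.

Context {X Y : topologicalType} {r : A -> set X} {s : B -> set Y}.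
Context (repr : represents r) (reps : represents s).

(** The dual of any relation is a subordination, so that it suffices to treat
    the generating pairs. Let F be in the disjunct i and G be related to F. In
    the first case a_i T e puts R[F], hence G, into the clopen of e, that is
    G in Box e; in the second case a point of F in b_il is related to a point
    of G in c_j. *)
Lemma krel_sound :
  krel T `<=` dual_sub (krep r) (krep s) (vrel (dual_rel r s T)).
Proof.
have repKr := krep_represents repr; have repKs := krep_represents reps.
apply: smallest_sub; first exact: dual_sub_subordination.
move=> [x y] [|] [l [m [[_ /= ->] [_ /= ->] lm]]] G [F] /(rep_bigjoin repKr);
  move=> [p pl]; rewrite (repI repKr) (krep_kbox repr);
  move=> [Fp /(rep_bigmeet repKr) Fd] [GF FG];
  apply/(rep_bigmeet repKs) => q qm; rewrite (repU repKs).
- right; apply/(rep_bigjoin repKs).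
  have [e eq Tpe] := lm p q pl qm; exists e => //.
  rewrite (krep_kbox reps) => y' /GF[x' /Fp px'] /(_ _ _ Tpe px').
  exact.
- left; have [b bp Tbq] := lm p q pl qm.
  have := Fd b bp; rewrite !krep_kdia // => -[x' [/FG[y' Gy' xy'] bx']].
  by exists y'; split=> //; exact: xy' Tbq bx'.
Qed.

(** The main lemma. If y in G were outside R[F], there would be a T b with F
    inside r a and y outside s b; then F lies in Box a, hence G in Box b. If
    x in F had no R-successor in G, there would be a T b with x in r a and
    s b disjoint from G; then F lies in Dia a, hence G in Dia b. *)
Lemma dual_rel_krel : subordination T ->
  dual_rel (krep r) (krep s) (krel T) = vrel (dual_rel r s T).
Proof.
move=> sT.
have repKr := krep_represents repr; have repKs := krep_represents reps.
have kX := rep_KHaus repr; have kY := rep_KHaus reps.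
set R := dual_rel r s T; have cR : closed R by exact: dual_rel_closed.
apply/seteqP; split=> -[F G]; last first.
  by move=> FG k l /krel_sound kl Fk; apply: kl; exists F.
move=> FG; split=> /=.
  move=> y Gy; apply: contrapT => nFy.
  have [|||a [b [Fa]]] := dual_sub_between repr reps cR
      (F := val F) (U := ~` [set y]).
  - exact: vietoris_closed.
  - exact/closed_openC/KHaus_closed1.
  - by move=> z Fz zy; rewrite zy in Fz.
  - rewrite (dual_relK repr reps) // => /krel_kbox Tab bU.
    have := FG _ _ Tab; rewrite !krep_kbox // => /(_ Fa y Gy) /bU.
    exact.
move=> x Fx; apply: contrapT => nGx.
have [|||a [b [xa]]] := dual_sub_between repr reps cR
    (F := [set x]) (U := ~` val G).
- exact: KHaus_closed1.
- exact/closed_openC/vietoris_closed.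
- by move=> y [_ -> Rxy] Gy; apply: nGx; exists y.
- rewrite (dual_relK repr reps) // => /krel_kdia Tab bU.
  have := FG _ _ Tab; rewrite !krep_kdia // => -[|y [Gy /bU]] //.
  by exists x; split=> //; exact: xa.
Qed.

Lemma krel_dual : subordination T ->
  krel T = dual_sub (krep r) (krep s) (vrel (dual_rel r s T)).
Proof.
move=> sT; rewrite -dual_rel_krel // dual_relK //.
- exact: krep_represents.
- exact: krep_represents.
- exact: krel_subordination.
Qed.

End krel_duality.

Lemma krel_dual_sub (d d' : Order.disp_t) (A : ctbDistrLatticeType d)
    (B : ctbDistrLatticeType d') (X Y : topologicalType) (r : A -> set X)
    (s : B -> set Y) (R : set (X * Y)) :
  represents r -> represents s -> closed R ->
  krel (dual_sub r s R) = dual_sub (krep r) (krep s) (vrel R).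
Proof.
move=> repr reps cR; rewrite (krel_dual repr reps).
  by rewrite dual_subK.
exact: dual_sub_subordination.
Qed.

(** * The functors *)

Section relation_calculus.
Context {X Y : Type}.

Lemma graph_rcompK (f : X -> Y) : range f = setT ->
  graph f \; (graph f)^-1 = diagonal.
Proof.
move=> fT; apply/seteqP; split=> -[y y'] /=.
  by move=> [x fy fy']; exact: etrans (esym fy) fy'.
move=> yy'; have [x _ fx] : range f y by rewrite fT.
by exists x => //; exact: etrans fx yy'.
Qed.

Lemma graph_kernel (f : X -> Y) :
  (graph f)^-1 \; graph f = [set p | f p.1 = f p.2].
Proof.
apply/seteqP; split=> -[x x'] /=.
  by move=> [y fx fx']; exact: etrans fx (esym fx').
by move=> fxx'; exists (f x').
Qed.

End relation_calculus.

Lemma closed_graph (X Y : topologicalType) (f : X -> Y) :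
  hausdorff_space Y -> continuous f -> closed (graph f).
Proof.
move=> hY cf.
have c : continuous (fun p : X * Y => (f p.1, p.2)).
  move=> p; apply: cvg_pair; last exact: cvg_snd.
  exact: (continuous_comp (@cvg_fst _ _ _ _ _) (cf p.1)).
exact: (continuous_closedP _).1 c _ (closed_diagonal hY).
Qed.

Section functors.
Context {C D E : relcat}.

Lemma functor_fcomp (F : assignment C D) (G : assignment D E) :
  is_functor F -> is_functor G -> is_functor (G ∘ F).
Proof.
move=> [oF hF iF cF] [oG hG iG cG]; split=> /=.
- by move=> A /oF/oG.
- by move=> A B R oA oB /(hF _ _ _ oA oB); apply: hG; exact: oF.
- by move=> A oA; rewrite iF // iG //; exact: oF.
- move=> A B K R T oA oB oK hR hT.
  rewrite (cF _ _ _ _ _ oA oB oK hR hT) cG //.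
  + exact: oF.
  + exact: oF.
  + exact: oF.
  + exact: hF.
  + exact: hF.
Qed.

End functors.

Lemma VK_functor : is_functor VK.
Proof.
split=> /=.
- exact: vietoris_KHaus.
- by move=> X Y R; exact: vrel_closed.
- by move=> X _; exact: vrel_diagonal.
- by move=> X Y Z R T; exact: vrel_comp.
Qed.

Lemma vrel_compatible (X Y : topologicalType) (E : set (X * X))
    (E' : set (Y * Y)) (R : set (X * Y)) : KHaus_space X -> KHaus_space Y ->
  closed E -> closed E' -> closed R -> compatible E E' R ->
  compatible (vrel E) (vrel E') (vrel R).
Proof.
by move=> kX kY cE cE' cR [RE ER]; split; rewrite -vrel_comp ?RE ?ER.
Qed.

Lemma S5s_KHaus X : is_S5_subordination_space X -> KHaus_space (space X).
Proof. by case=> -[]. Qed.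

Lemma VS_functor : is_functor VS.
Proof.
split=> /=.
- move=> X hX; have kX := S5s_KHaus hX; case: hX => sX cE rE sE tE; split=> /=.
  + exact: rep_Stone (krep_represents (clop_represents sX)).
  + exact: vrel_closed.
  + exact: vrel_refl.
  + exact: vrel_sym.
  + exact: vrel_trans.
- move=> X Y R hX hY [cR eR]; have kX := S5s_KHaus hX; have kY := S5s_KHaus hY.
  split; first exact: vrel_closed.
  by apply: vrel_compatible => //; exact: S5s_closed.
- by [].
- move=> X Y Z R T /S5s_KHaus kX /S5s_KHaus kY /S5s_KHaus kZ [cR _] [cT _].
  exact: vrel_comp.
Qed.

Lemma Clopf_functor : is_functor Clopf.
Proof.
split=> /=.
- by move=> X [sX cE rE sE tE]; exact: (dual_sub_S5 (clop_represents sX)).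
- move=> X Y R [sX cE _ _ _] [sY cE' _ _ _] [cR [RE ER]].
  have rX := clop_represents sX; have rY := clop_represents sY.
  split; first exact: (dual_sub_subordination rX rY).
  split=> /=; first by rewrite -(dual_sub_comp rX rX rY cE cR) RE.
  by rewrite -(dual_sub_comp rX rY rY cR cE') ER.
- by [].
- move=> X Y Z R T [sX _ _ _ _] [sY _ _ _ _] [sZ _ _ _ _] [cR _] [cT _].
  exact: (dual_sub_comp (clop_represents sX) (clop_represents sY)
    (clop_represents sZ)).
Qed.

Lemma uf_relE (d d' : Order.disp_t) (A : ctbDistrLatticeType d)
    (B : ctbDistrLatticeType d') (T : set (A * B)) :
  uf_rel T = dual_rel (@uf_basic d A) (@uf_basic d' B) T.
Proof.
apply/seteqP; split=> -[x y] /= xy.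
  by move=> a b Tab xa; apply: xy; exists a.
by move=> b [a xa Tab]; exact: xy Tab xa.
Qed.

Lemma uf_rel_comp (d d' d'' : Order.disp_t) (A : ctbDistrLatticeType d)
    (B : ctbDistrLatticeType d') (C : ctbDistrLatticeType d'')
    (S : set (A * B)) (T : set (B * C)) :
  subordination S -> subordination T ->
  uf_rel (T \; S) = uf_rel T \; uf_rel S.
Proof.
by move=> sS sT; rewrite !uf_relE; apply: dual_rel_comp => //;
  exact: uf_represents.
Qed.

Lemma uf_rel_closed (d d' : Order.disp_t) (A : ctbDistrLatticeType d)
    (B : ctbDistrLatticeType d') (T : set (A * B)) : closed (uf_rel T).
Proof. by rewrite uf_relE; apply: dual_rel_closed; exact: uf_represents. Qed.

Lemma uf_KHaus (d : Order.disp_t) (B : ctbDistrLatticeType d) :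
  KHaus_space (uf B).
Proof. exact: rep_KHaus uf_represents. Qed.

Lemma Uff_functor : is_functor Uff.
Proof.
split=> /=.
- move=> [d B S] oB; rewrite /= uf_relE.
  exact: (dual_rel_S5 uf_represents).
- move=> A B T [sA _ _ _] [sB _ _ _] [sT [TS ST]].
  split; first exact: uf_rel_closed.
  by split=> /=; rewrite -uf_rel_comp // ?TS ?ST.
- by [].
- by move=> A B C S T _ _ _ [sS _] [sT _]; exact: uf_rel_comp.
Qed.

(** Transported from [vrel_comp] along the representations of the algebras on
    their ultrafilters. *)
Lemma krel_comp (d d' d'' : Order.disp_t) (A : ctbDistrLatticeType d)
    (B : ctbDistrLatticeType d') (C : ctbDistrLatticeType d'')
    (S : set (A * B)) (T : set (B * C)) :
  subordination S -> subordination T ->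
  krel (T \; S) = krel T \; krel S.
Proof.
move=> sS sT.
have rA := @uf_represents _ A; have rB := @uf_represents _ B.
have rC := @uf_represents _ C.
rewrite (krel_dual rA rB sS) (krel_dual rB rC sT).
rewrite -(dual_relK rA rB sS) -(dual_relK rB rC sT).
rewrite -(dual_sub_comp rA rB rC); try exact: dual_rel_closed.
rewrite krel_dual_sub //; last first.
  apply: closed_rcomp; try exact: uf_KHaus; exact: dual_rel_closed.
rewrite vrel_comp; try exact: uf_KHaus; try exact: dual_rel_closed.
rewrite !(dual_relK rA rB sS) !(dual_relK rB rC sT).
by apply: (dual_sub_comp (krep_represents rA) (krep_represents rB)
    (krep_represents rC)); apply: vrel_closed;
  try exact: uf_KHaus; exact: dual_rel_closed.
Qed.

Lemma KS_functor : is_functor KS.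
Proof.
split=> /=.
- move=> [d B S] oB; have /= sS := S5a_sub oB.
  rewrite /= (krel_dual uf_represents uf_represents sS).
  have [/= _ cE rE sE tE] := dual_rel_S5 uf_represents oB.
  apply: (dual_sub_S5 (krep_represents uf_represents)).
  + by apply: vrel_closed => //; exact: uf_KHaus.
  + exact: vrel_refl.
  + exact: vrel_sym.
  + exact: vrel_trans.
- move=> A B T [sA _ _ _] [sB _ _ _] [sT [TS ST]].
  split; first exact: krel_subordination.
  by split=> /=; rewrite -krel_comp // ?TS ?ST.
- by [].
- by move=> A B C S T _ _ _ [sS _] [sT _]; exact: krel_comp.
Qed.

(** * The quotient of a space by a closed equivalence relation *)

Section quotient_space.
Context {X : topspace_rel} (hX : is_S5_subordination_space X).

Lemma quot_piP x y : quot_pi x = quot_pi y :> quot X <-> srel X (x, y).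
Proof.
have piE z : quot_pi z = class_pi (srel X) z :> quot X.
  by rewrite /quot_pi unlock.
rewrite !piE; split=> [/(congr1 (@sval _ _)) /= xy|xy].
  have : eclass (srel X) y y by exact: (S5s_refl hX).
  by rewrite -xy.
rewrite /class_pi; apply: eq_exist => /=.
apply/seteqP; split=> z /=; apply: (S5s_trans hX) => //.
exact: (S5s_sym hX).
Qed.

Lemma quot_pi_continuous : continuous (@quot_pi X).
Proof. exact: pi_continuous. Qed.

Lemma quot_pi_surj : range (@quot_pi X) = setT.
Proof.
apply/seteqP; split=> // c _; exists (repr c) => //.
exact: reprK.
Qed.

(** Distinct classes are disjoint closed sets, separated by open sets U and V;
    the classes contained in U and those contained in V are disjoint, and they
    form open sets because the union of the classes contained in an open set
    is open. *)
Lemma quot_KHaus : KHaus_space (quot X).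
Proof.
have kX := S5s_KHaus hX; split.
  rewrite -quot_pi_surj; apply: continuous_compact kX.1.
  by apply: continuous_subspaceT; exact: quot_pi_continuous.
rewrite open_hausdorff => c c'.
rewrite -[c]reprK -[c']reprK; set x := repr c; set y := repr c'.
move=> /eqP xy; have nxy : ~ srel X (x, y) by move/quot_piP.
have clE z : closed (rimage (srel X) [set z]).
  by apply: closed_rimage (S5s_closed hX) _ => //; exact: KHaus_closed1.
have [|U [V [oU oV xU yV UV]]] := KHaus_separate kX (clE x) (clE y).
  move=> z [_ -> xz] [_ -> yz]; apply: nxy.
  exact: (S5s_trans hX) xz (S5s_sym hX yz).
(* The saturated part of W, as a set of classes. *)
pose core (W : set (space X)) := [set c : quot X | exists2 z, quot_pi z = c &
  rimage (srel X) [set z] `<=` W].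
have core_open W : open W -> open (core W).
  move=> oW; suff : open (@quot_pi X @^-1` core W) by [].
  rewrite (_ : _ @^-1` _ = [set z | rimage (srel X) [set z] `<=` W]).
    exact: open_rimage_sub (S5s_closed hX) oW.
  apply/seteqP; split=> z; last by exists z.
  move=> [z' /quot_piP zz' z'W] w [_ -> zw]; apply: z'W.
  by exists z' => //; exact: (S5s_trans hX) zz' zw.
exists (core U, core V); rewrite ?inE /=.
  by split; [exists x|exists y].
split; [exact: core_open|exact: core_open|].
apply/seteqP; split=> // _ [[z <- zU] [z' /quot_piP zz' z'V]].
apply: (UV z); first by apply: zU; exists z => //; exact: S5s_refl.
by apply: z'V; exists z'.
Qed.

End quotient_space.

(** * Covers *)

(** The relational content of a surjection with kernel E: in the calculus of
    relations P behaves as a co-isometry, with P^-1 as its adjoint. *)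
Definition covers (Z X : Type) (E : set (Z * Z)) (P : set (Z * X)) : Prop :=
  P \; P^-1 = diagonal /\ P^-1 \; P = E.

Section cover_calculus.
Context {Z X : Type} {E : set (Z * Z)} {P : set (Z * X)} (cP : covers E P).

Lemma cover_cancel (Y : Type) (A : set (X * Y)) : (A \; P) \; P^-1 = A.
Proof. by rewrite -rcompA cP.1 rcomp_diagonalr. Qed.

Lemma cover_kernel (Y : Type) (A : set (Z * Y)) :
  (A \; P^-1) \; P = A \; E.
Proof. by rewrite -rcompA cP.2. Qed.

Lemma cover_compatr : P \; E = P.
Proof. by rewrite -cover_kernel cP.1 rcomp_diagonall. Qed.

Lemma cover_compatl : E \; P^-1 = P^-1.
Proof. by rewrite -cP.2 cover_cancel. Qed.

End cover_calculus.

(** Two quotients by the same equivalence relation are isomorphic. *)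
Lemma covers_iso (Z X W : Type) (E : set (Z * Z)) (P : set (Z * X))
    (Q : set (Z * W)) : covers E P -> covers E Q ->
  (P \; Q^-1) \; (Q \; P^-1) = diagonal.
Proof.
by move=> cP cQ; rewrite !rcompA (cover_kernel cQ) (cover_compatr cP) cP.1.
Qed.

(** Here R \; E = R and E' \; R = R let the kernels that arise from P'^-1 \; P'
    and Q^-1 \; Q be absorbed by R. *)
Lemma covers_natural (Z X W Z' X' W' : Type) (E : set (Z * Z))
    (P : set (Z * X)) (Q : set (Z * W)) (E' : set (Z' * Z'))
    (P' : set (Z' * X')) (Q' : set (Z' * W')) (R : set (Z * Z')) :
  covers E Q -> covers E' P' -> compatible E E' R ->
  (Q' \; P'^-1) \; ((P' \; R) \; P^-1) = ((Q' \; R) \; Q^-1) \; (Q \; P^-1).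
Proof.
move=> cQ cP' [RE ER].
rewrite !rcompA (cover_kernel cP') (cover_kernel cQ).
by rewrite -(rcompA R E' Q') ER -(rcompA E R Q') RE.
Qed.

Lemma lift_compatible (Z X Z' X' : Type) (E : set (Z * Z)) (P : set (Z * X))
    (E' : set (Z' * Z')) (P' : set (Z' * X')) (R : set (X * X')) :
  covers E P -> covers E' P' -> compatible E E' ((P'^-1 \; R) \; P).
Proof.
move=> cP cP'; split; first by rewrite -rcompA (cover_compatr cP).
by rewrite !rcompA (cover_compatl cP').
Qed.

(** P^-1 \; Q lifts the identity of X to the spaces that cover it; it is
    compatible, and by [lift_iso] an isomorphism with inverse Q^-1 \; P. *)
Lemma transfer_compatible (Z W X : Type) (E : set (Z * Z)) (P : set (Z * X))
    (F : set (W * W)) (Q : set (W * X)) :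
  covers E P -> covers F Q -> compatible F E (P^-1 \; Q).
Proof.
move=> cP cQ; have := lift_compatible diagonal cQ cP.
by rewrite rcomp_diagonalr.
Qed.

Lemma lift_iso (Z X W : Type) (E : set (Z * Z)) (F : set (W * W))
    (P : set (Z * X)) (Q : set (W * X)) : covers E P -> covers F Q ->
  (P^-1 \; Q) \; (Q^-1 \; P) = E.
Proof. by move=> cP cQ; rewrite !rcompA (cover_cancel cQ) cP.2. Qed.

Lemma lift_comp (Z X W V Y : Type) (E : set (Z * Z)) (P : set (Z * X))
    (Q : set (W * Y)) (S : set (V * X)) (R : set (X * Y)) : covers E P ->
  ((Q^-1 \; R) \; P) \; (P^-1 \; S) = (Q^-1 \; R) \; S.
Proof. by move=> cP; rewrite rcompA (cover_cancel cP). Qed.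

Lemma graph_covers (Z X : Type) (f : Z -> X) : range f = setT ->
  covers [set z | f z.1 = f z.2] (graph f).
Proof. by move=> fT; split; [exact: graph_rcompK|exact: graph_kernel]. Qed.

Lemma vrel_covers (Z X : topologicalType) (E : set (Z * Z))
    (P : set (Z * X)) : KHaus_space Z -> KHaus_space X -> closed P ->
  covers E P -> covers (vrel E) (vrel P).
Proof.
move=> kZ kX cP [PP PE]; have cP' := closed_converse cP.
by split; rewrite -vrel_converse -vrel_comp ?PP ?PE // vrel_diagonal.
Qed.

Section quotient_functor.
Context {X : topspace_rel} (hX : is_S5_subordination_space X).

Lemma quot_covers : covers (srel X) (graph (@quot_pi X)).
Proof.
have [pp pE] := graph_covers (@quot_pi_surj X); split=> //; rewrite pE.
by apply/seteqP; split=> -[x y] /(quot_piP hX).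
Qed.

Lemma quot_graph_closed : closed (graph (@quot_pi X)).
Proof. exact: closed_graph (quot_KHaus hX).2 (@quot_pi_continuous X). Qed.

End quotient_functor.

Lemma Qf_functor : is_functor Qf.
Proof.
split.
- by move=> X; exact: quot_KHaus.
- move=> X Y R hX hY [cR _].
  have kX := S5s_KHaus hX; have kY := S5s_KHaus hY.
  have qX := quot_KHaus hX; have qY := quot_KHaus hY.
  exact: (closed_rcomp qX kX qY (closed_converse (quot_graph_closed hX))
    (closed_rcomp kX kY qY cR (quot_graph_closed hY))).
- move=> X hX.
  change ((graph (@quot_pi X) \; srel X) \; (graph (@quot_pi X))^-1 = diagonal).
  by rewrite (cover_compatr (quot_covers hX)) (quot_covers hX).1.
- move=> X Y Z R T hX hY hZ [cR [RE ER]] [cT [TE ET]].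
  change ((graph (@quot_pi Z) \; (T \; R)) \; (graph (@quot_pi X))^-1 =
    ((graph (@quot_pi Z) \; T) \; (graph (@quot_pi Y))^-1) \;
    ((graph (@quot_pi Y) \; R) \; (graph (@quot_pi X))^-1)).
  by rewrite !rcompA (cover_kernel (quot_covers hY)) -(rcompA (srel Y) T) TE.
Qed.

(** * The natural isomorphisms *)

(** The lifted quotient map V(X) -> V(X / E) and the quotient map of V(X) both
    cover their codomain with kernel V(E); hence the converse of the first
    followed by the second is an isomorphism. *)
Lemma VK_Qf_iso : VK ∘ Qf ≃ Qf ∘ VS.
Proof.
split; [exact: functor_fcomp Qf_functor VK_functor|
        exact: functor_fcomp VS_functor Qf_functor|].
pose p X := graph (@quot_pi X).
pose q X := graph (@quot_pi (fobj VS X)).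
have kVS X : is_S5_subordination_space X ->
    is_S5_subordination_space (fobj VS X) by exact: functor_obj VS_functor _.
have coverp X : is_S5_subordination_space X ->
    covers (vrel (srel X)) (vrel (p X)).
  move=> hX; apply: vrel_covers (quot_covers hX); first exact: S5s_KHaus.
    exact: quot_KHaus.
  exact: quot_graph_closed.
have coverq X : is_S5_subordination_space X -> covers (vrel (srel X)) (q X).
  by move=> /kVS hX; exact: (quot_covers hX).
exists (fun X => q X \; (vrel (p X))^-1); split.
  move=> X hX; have Pp := coverp X hX; have Pq := coverq X hX.
  have kX := S5s_KHaus hX; have qX := quot_KHaus hX.
  have vkX := vietoris_KHaus kX; have vqX := vietoris_KHaus qX.
  have qvX := quot_KHaus (kVS _ hX).
  have cp : closed (vrel (p X)).
    exact: vrel_closed kX qX (quot_graph_closed hX).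
  have cq : closed (q X) := quot_graph_closed (kVS _ hX).
  split; first exact: closed_rcomp vqX vkX qvX (closed_converse cp) cq.
  exists (vrel (p X) \; (q X)^-1); split=> /=.
  - exact: closed_rcomp qvX vkX vqX (closed_converse cq) cp.
  - exact: covers_iso Pp Pq.
  - exact: covers_iso Pq Pp.
move=> X Y R hX hY [cR [RE ER]].
have kX := S5s_KHaus hX; have kY := S5s_KHaus hY.
have [|VRE VER] := vrel_compatible kX kY (S5s_closed hX) (S5s_closed hY) cR.
  by [].
have qX := quot_KHaus hX; have qY := quot_KHaus hY.
have cpX := quot_graph_closed hX; have cpY := quot_graph_closed hY.
change ((q Y \; (vrel (p Y))^-1) \; vrel ((p Y \; R) \; (p X)^-1) =
  ((q Y \; vrel R) \; (q X)^-1) \; (q X \; (vrel (p X))^-1)).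
rewrite (vrel_comp qX kX qY (closed_converse cpX)
  (closed_rcomp kX kY qY cR cpY)).
rewrite (vrel_comp kX kY qY cR cpY) vrel_converse.
exact: covers_natural (coverq X hX) (coverp Y hY) _.
Qed.

(** Points are separated by disjoint open sets U and V, and the closure of U is
    a clopen that misses V. *)
Lemma extremally_disconnected_Stone (X : topologicalType) :
  KHaus_space X -> extremally_disconnected X -> Stone_space X.
Proof.
move=> kX eX; split=> // x y /eqP xy.
have [|U [V [oU oV xU yV UV]]] :=
    KHaus_separate kX (KHaus_closed1 (x := x) kX) (KHaus_closed1 (x := y) kX).
  by move=> _ -> /xy.
exists (closure U); split.
- by split; [exact: eX|exact: closed_closure].
- by apply: subset_closure; exact: xU.
- move=> /(_ V (open_nbhs_nbhs (conj oV (yV y erefl))))[z [Uz Vz]].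
  exact: UV Uz Vz.
Qed.

Section Gleason_functor.
Context (hat : topologicalType -> topologicalType)
  (g : forall X : topologicalType, hat X -> X)
  (g_Gleason : forall X, KHaus_space X -> is_Gleason_cover (@g X)).
Arguments g : clear implicits.

Lemma Gleason_covers X : KHaus_space X ->
  covers [set p | g X p.1 = g X p.2] (graph (g X)).
Proof. by move=> kX; exact: graph_covers (Gleason_surj (g_Gleason kX)). Qed.

Lemma Gleason_graph_closed X : KHaus_space X -> closed (graph (g X)).
Proof.
by move=> kX; exact: closed_graph kX.2 (Gleason_continuous (g_Gleason kX)).
Qed.

Lemma Gf_functor : is_functor (Gf g).
Proof.
have kh X (kX : KHaus_space X) := Gleason_KHaus (g_Gleason kX).
split.
- move=> X kX; have kgX := kh X kX; split=> /=.
  + exact: extremally_disconnected_Stone kgX (Gleason_ed (g_Gleason kX)).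
  + rewrite -graph_kernel; have cg := Gleason_graph_closed kX.
    exact (closed_rcomp kgX kX kgX cg (closed_converse cg)).
  + by [].
  + by [].
  + by move=> x y z /= -> .
- move=> X Y R kX kY cR; have kgX := kh X kX; have kgY := kh Y kY.
  have cX := Gleason_covers kX; have cY := Gleason_covers kY.
  split.
    exact: closed_rcomp kgX kX kgY (Gleason_graph_closed kX)
      (closed_rcomp kX kY kgY cR (closed_converse (Gleason_graph_closed kY))).
  exact: lift_compatible cX cY.
- move=> X kX.
  change (((graph (g X))^-1 \; @diagonal X) \; graph (g X) =
    [set p | g X p.1 = g X p.2]).
  by rewrite rcomp_diagonalr (Gleason_covers kX).2.
- move=> X Y Z R T kX kY kZ cR cT.
  change (((graph (g Z))^-1 \; (T \; R)) \; graph (g X) =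
    (((graph (g Z))^-1 \; T) \; graph (g Y)) \;
    (((graph (g Y))^-1 \; R) \; graph (g X))).
  by rewrite !rcompA (cover_cancel (Gleason_covers kY)).
Qed.

(** Both the Gleason cover of V(X) and the lifting of the Gleason cover of X
    cover V(X), so the identity of V(X) lifts to an isomorphism of their
    domains with their kernels. *)
Lemma Gf_VK_iso : Gf g ∘ VK ≃ VS ∘ Gf g.
Proof.
have FG := functor_fcomp VK_functor Gf_functor.
have GF := functor_fcomp Gf_functor VS_functor.
split=> //.
have kh X (kX : KHaus_space X) := Gleason_KHaus (g_Gleason kX).
pose p X := graph (g X).
pose q X := graph (g (vietoris X)).
have coverp X : KHaus_space X ->
    covers (vrel [set z | g X z.1 = g X z.2]) (vrel (p X)).
  move=> kX; apply: vrel_covers (Gleason_covers kX) => //; first exact: kh.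
  exact: Gleason_graph_closed.
have coverq X : KHaus_space X ->
    covers [set z | g (vietoris X) z.1 = g (vietoris X) z.2] (q X).
  by move=> /vietoris_KHaus; exact: Gleason_covers.
exists (fun X => (vrel (p X))^-1 \; q X); split.
  move=> X kX; have Pp := coverp X kX; have Pq := coverq X kX.
  have vkX := vietoris_KHaus kX; have kgX := kh X kX.
  have vkgX := vietoris_KHaus kgX; have kgvX := kh _ vkX.
  have cp : closed (vrel (p X)).
    exact: vrel_closed kgX kX (Gleason_graph_closed kX).
  have cq : closed (q X) := Gleason_graph_closed vkX.
  split.
    split; first exact: closed_rcomp kgvX vkX vkgX cq (closed_converse cp).
    exact: transfer_compatible Pp Pq.
  exists ((q X)^-1 \; vrel (p X)); split.
  - split; first exact: closed_rcomp vkgX vkX kgvX cp (closed_converse cq).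
    exact: transfer_compatible Pq Pp.
  - exact: lift_iso Pq Pp.
  - exact: lift_iso Pp Pq.
move=> X Y R kX kY cR.
have kgX := kh X kX; have kgY := kh Y kY.
have cpX := Gleason_graph_closed kX; have cpY := Gleason_graph_closed kY.
change (((vrel (p Y))^-1 \; q Y) \; (((q Y)^-1 \; vrel R) \; q X) =
  vrel (((p Y)^-1 \; R) \; p X) \; ((vrel (p X))^-1 \; q X)).
rewrite (vrel_comp kgX kX kgY cpX
  (closed_rcomp kX kY kgY cR (closed_converse cpY))).
rewrite (vrel_comp kX kY kgY cR (closed_converse cpY)) vrel_converse.
by rewrite (lift_comp _ _ _ (coverp X kX)) !rcompA (cover_cancel (coverq Y kY)).
Qed.

End Gleason_functor.

(** clop (V X) and K (clop X) are represented on the same space V X; the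
    isomorphism is the dual of V(E) across these representations, and each
    required equation is the dual of V(E) \; V(E) = V(E), V(R) \; V(E) = V(R)
    or V(E) \; V(R) = V(R). *)
Lemma Clopf_VS_iso : Clopf ∘ VS ≃ KS ∘ Clopf.
Proof.
split; [exact: functor_fcomp VS_functor Clopf_functor|
        exact: functor_fcomp Clopf_functor KS_functor|].
pose r (X : topspace_rel) := fun U : clop (vietoris (space X)) => val U.
pose s (X : topspace_rel) := krep (fun U : clop (space X) => val U).
have repr X : is_S5_subordination_space X -> represents (r X).
  move=> hX; apply: clop_represents.
  exact: S5s_stone (functor_obj VS_functor hX).
have reps X : is_S5_subordination_space X -> represents (s X).
  by move=> hX; exact: krep_represents (clop_represents (S5s_stone hX)).
have cV X Y (R : set (space X * space Y)) : is_S5_subordination_space X ->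
    is_S5_subordination_space Y -> closed R -> closed (vrel R).
  by move=> /S5s_KHaus kX /S5s_KHaus kY; exact: vrel_closed.
have EE X (hX : is_S5_subordination_space X) : vrel (srel X) \; vrel (srel X) =
    vrel (srel X).
  exact: (StoneE_id (functor_obj VS_functor hX)).2.1.
have krelE X Y (R : set (space X * space Y)) : is_S5_subordination_space X ->
    is_S5_subordination_space Y -> closed R ->
    krel (clop_rel R) = dual_sub (s X) (s Y) (vrel R).
  move=> hX hY; apply: krel_dual_sub; exact/clop_represents/S5s_stone.
exists (fun X => dual_sub (r X) (s X) (vrel (srel X))); split.
  move=> X hX; have rX := repr X hX; have sX := reps X hX.
  have cE := cV _ _ _ hX hX (S5s_closed hX).
  have kE := krelE _ _ _ hX hX (S5s_closed hX).
  have E2 := EE X hX.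
  split.
    split; first exact: dual_sub_subordination.
    split; first by rewrite /= -(dual_sub_comp rX rX sX cE cE) E2.
    by rewrite /= kE -(dual_sub_comp rX sX sX cE cE) E2.
  exists (dual_sub (s X) (r X) (vrel (srel X))); split.
  - split; first exact: dual_sub_subordination.
    split; first by rewrite /= kE -(dual_sub_comp sX sX rX cE cE) E2.
    by rewrite /= -(dual_sub_comp sX rX rX cE cE) E2.
  - by rewrite -(dual_sub_comp rX sX rX cE cE) E2.
  - by rewrite -(dual_sub_comp sX rX sX cE cE) E2 /= kE.
move=> X Y R hX hY [cR eR].
have [VRE VER] := vrel_compatible (S5s_KHaus hX) (S5s_KHaus hY)
  (S5s_closed hX) (S5s_closed hY) cR eR.
have cEX := cV _ _ _ hX hX (S5s_closed hX).
have cEY := cV _ _ _ hY hY (S5s_closed hY).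
have cVR := cV _ _ _ hX hY cR.
rewrite /= (krelE _ _ _ hX hY cR).
rewrite -(dual_sub_comp (repr X hX) (reps X hX) (reps Y hY) cEX cVR) VRE.
by rewrite -(dual_sub_comp (repr X hX) (repr Y hY) (reps Y hY) cVR cEY) VER.
Qed.

(** uf (K B) and V (uf B) represent the same algebra K B; the isomorphism is the
    dual of K(S) across these representations, and each required equation is
    the dual of K(S) \; K(S) = K(S) or of the compatibility of K(T). *)
Lemma Uff_KS_iso : Uff ∘ KS ≃ VS ∘ Uff.
Proof.
split; [exact: functor_fcomp KS_functor Uff_functor|
        exact: functor_fcomp Uff_functor VS_functor|].
pose r (B : balg_rel) := @uf_basic _ (kalg (balg B)).
pose s (B : balg_rel) := krep (@uf_basic _ (balg B)).
have repr B : represents (r B) by exact: uf_represents.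
have reps B : represents (s B) by exact/krep_represents/uf_represents.
have vrelE A B (T : set (balg A * balg B)) : subordination T ->
    vrel (uf_rel T) = dual_rel (s A) (s B) (krel T).
  by move=> sT; rewrite uf_relE dual_rel_krel //; exact: uf_represents.
exists (fun B => dual_rel (r B) (s B) (krel (brel B))); split.
  move=> B hB; have rB := repr B; have sB := reps B.
  have sS := S5a_sub hB; have sK := krel_subordination (brel B).
  have K2 : krel (brel B) \; krel (brel B) = krel (brel B).
    exact: (SubS5_id (functor_obj KS_functor hB)).2.1.
  split.
    split; first exact: dual_rel_closed.
    split; first by rewrite /= uf_relE -(dual_rel_comp rB rB sB sK sK) K2.
    by rewrite /= vrelE // -(dual_rel_comp rB sB sB sK sK) K2.
  exists (dual_rel (s B) (r B) (krel (brel B))); split.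
  - split; first exact: dual_rel_closed.
    split; first by rewrite /= vrelE // -(dual_rel_comp sB sB rB sK sK) K2.
    by rewrite /= uf_relE -(dual_rel_comp sB rB rB sK sK) K2.
  - by rewrite -(dual_rel_comp rB sB rB sK sK) K2 /= uf_relE.
  - by rewrite -(dual_rel_comp sB rB sB sK sK) K2 /= vrelE.
move=> A B T hA hB hT; have sT := hT.1.
have sKA := krel_subordination (brel A).
have sKB := krel_subordination (brel B).
have sKT := krel_subordination T.
have [KTS KST] : compatible (krel (brel A)) (krel (brel B)) (krel T).
  exact: (functor_hom KS_functor hA hB hT).2.
rewrite /= vrelE // uf_relE.
rewrite -(dual_rel_comp (repr A) (reps A) (reps B) sKA sKT) KTS.
by rewrite -(dual_rel_comp (repr A) (repr B) (reps B) sKT sKB) KST.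
Qed.

Theorem theorem8p4 (hat : topologicalType -> topologicalType)
    (g : forall X : topologicalType, hat X -> X)
    (g_Gleason : forall X, KHaus_space X -> is_Gleason_cover (g X)) :
  [/\ is_functor VS /\ is_functor KS,
      VK ∘ Qf ≃ Qf ∘ VS,
      Gf g ∘ VK ≃ VS ∘ Gf g,
      Clopf ∘ VS ≃ KS ∘ Clopf &
      Uff ∘ KS ≃ VS ∘ Uff].
Proof.
split.
- by split; [exact: VS_functor|exact: KS_functor].
- exact: VK_Qf_iso.
- exact: Gf_VK_iso.
- exact: Clopf_VS_iso.
- exact: Uff_KS_iso.
Qed.
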